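(* Let $\Omega\subset\mathbb{R}^N$ be a smooth bounded domain and $0<\alpha<1$. Assume that there exist a subsolution $u_0$ and a supersolution $u^0$ of the problem $$-\Delta u=\frac{1}{u^\alpha}\ \text{ in }\Omega,\qquad u=0\ \text{ on }\partial\Omega,$$ such that $u_0\le u^0$, and constants $c_1,c_2$ such that $$0<c_1 d(x)\le u_0(x)\le u^0(x)\le c_2 d(x)\quad\text{in }\Omega .$$ Then there exist a minimal solution $\underline{u}$ and a maximal solution $\overline{u}$ of the problem (in the interval $[u_0,u^0]$), with $$u_0\le \underline{u}\le\overline{u}\le u^0 .$$
   Context: $d(x)=\mathrm{dist}(x,\partial\Omega)$. Functions $u_0,u^0\in H^1_0(\Omega)\cap L^\infty(\Omega)$ are called respectively a subsolution and a supersolution of the problem if $$\int_\Omega\nabla u_0\cdot\nabla v\,dx-\int_\Omega u_0^{-\alpha}v\,dx\le 0\le\int_\Omega\nabla u^0\cdot\nabla v\,dx-\int_\Omega (u^0)^{-\alpha}v\,dx\quad\text{for all }v\in H^1_0(\Omega),\ v\ge 0.$$ A (weak) solution $u$ with $u_0\le u\le u^0$ is a function $u\in H^1_0(\Omega)$ with $\int_\Omega\nabla u\cdot\nabla v\,dx=\int_\Omega u^{-\alpha}v\,dx$ for all $v\in H^1_0(\Omega)$. Minimal (resp. maximal) means: every solution $u$ with $u_0\le u\le u^0$ a.e. in $\Omega$ satisfies $\underline{u}\le u$ (resp. $u\le\overline{u}$). All inequalities between functions are a.e. in $\Omega$. *)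

(* Defs.v *)
From HB Require Import structures.
From mathcomp Require Import all_boot all_order all_algebra.
From mathcomp Require Import all_classical all_reals all_analysis.

Set Implicit Arguments.
Unset Strict Implicit.
Unset Printing Implicit Defensive.
Import Order.TTheory GRing.Theory Num.Theory.
Import numFieldNormedType.Exports.
Local Open Scope classical_set_scope.
Local Open Scope ring_scope.

(* The Borel sigma-algebra of R^n, generated by the coordinate projections. *)

Fact rV_display : measure_display.
Proof. exact: default_measure_display. Qed.

Section rV_measurable.
Context {R : realType} {n : nat}.

Definition rV_coord (i : 'I_n) (x : 'rV[R]_n) : R := x ord0 i.

Let rV_set0 : g_sigma_preimage rV_coord set0.
Proof. exact: sigma_algebra0. Qed.

Let rV_setC A : g_sigma_preimage rV_coord A -> g_sigma_preimage rV_coord (~` A).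
Proof. exact: sigma_algebraC. Qed.

Let rV_bigcup (F : (set 'rV[R]_n)^nat) :
  (forall i, g_sigma_preimage rV_coord (F i)) ->
  g_sigma_preimage rV_coord (\bigcup_i F i).
Proof. exact: sigma_algebra_bigcup. Qed.

HB.instance Definition _ := @isMeasurable.Build rV_display 'rV[R]_n
  (g_sigma_preimage rV_coord) rV_set0 rV_setC rV_bigcup.

End rV_measurable.

Lemma measurable_rV_coord (R : realType) n (i : 'I_n) :
  measurable_fun [set: 'rV[R]_n] (rV_coord i).
Proof.
move=> _ Y mY; rewrite setTI; apply: sub_sigma_algebra => /=.
rewrite -bigcup_seq/=; exists i => /=; first by rewrite mem_index_enum.
by exists Y => //; rewrite setTI.
Qed.

Lemma measurable_fun_rV_coordP d (T : measurableType d) (R : realType) n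
    (f : T -> 'rV[R]_n) :
  measurable_fun [set: T] f <->
  forall i, measurable_fun [set: T] (rV_coord i \o f).
Proof.
split=> [mf i|mf].
  by apply: measurableT_comp => //; exact: measurable_rV_coord.
suff H : g_sigma_preimage (fun i => rV_coord i \o f) `<=` measurable.
  move=> _ A mA; apply: H; rewrite g_sigma_preimage_comp.
  by exists A.
apply: smallest_sub; first exact: sigma_algebra_measurable.
case: n => [|n] in f mf *; first by rewrite big_ord0.
rewrite -bigcup_mkord_ord; apply: bigcup_sub => i Ii.
by move=> A [B mB <-]; exact: mf.
Qed.

(* Lebesgue measure on R^n, as the n-fold product of the Lebesgue measure on
   R (on R^0 it is the unit mass of the point). *)

Section lebesgue_rV.
Context {R : realType}.

Definition rV_cons n (p : measurableTypeR R * 'rV[R]_n) : 'rV[R]_n.+1 :=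
  \row_j (if unlift ord0 j is Some i then p.2 ord0 i else p.1).

Lemma rV_cons0 n p : @rV_cons n p ord0 ord0 = p.1.
Proof. by rewrite mxE unlift_none. Qed.

Lemma rV_consS n p i : @rV_cons n p ord0 (lift ord0 i) = p.2 ord0 i.
Proof. by rewrite mxE liftK. Qed.

Lemma measurable_rV_cons n : measurable_fun [set: _] (@rV_cons n).
Proof.
apply/measurable_fun_rV_coordP => i.
case: (unliftP ord0 i) => [j|] ->.
  rewrite (_ : _ \o _ = rV_coord j \o snd); last first.
    by apply/funext => p; exact: rV_consS.
  by apply: measurableT_comp; [exact: measurable_rV_coord|].
rewrite (_ : _ \o _ = fst); first exact: measurable_fst.
by apply/funext => p; exact: rV_cons0.
Qed.

Section step.
Variables (n : nat) (m : {sigma_finite_measure set 'rV[R]_n -> \bar R}).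

Definition lebesgue_step : set 'rV[R]_n.+1 -> \bar R :=
  pushforward (lebesgue_measure \x m)%E (@rV_cons n).

Let lebesgue_step0 : lebesgue_step set0 = 0%E.
Proof. by rewrite /lebesgue_step /pushforward preimage_set0 measure0. Qed.

Let lebesgue_step_ge0 A : (0 <= lebesgue_step A)%E.
Proof. by rewrite /lebesgue_step /pushforward; exact: measure_ge0. Qed.

Let lebesgue_step_sigma_additive : semi_sigma_additive lebesgue_step.
Proof.
move=> F mF tF mUF; rewrite /lebesgue_step /pushforward preimage_bigcup.
apply: measure_semi_sigma_additive.
- by move=> k; rewrite -[X in measurable X]setTI; exact: measurable_rV_cons.
- by apply/trivIsetP => /= i j _ _ ij; rewrite -preimage_setI;
    move/trivIsetP : tF => -> //; rewrite preimage_set0.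
- by rewrite -preimage_bigcup -[X in measurable X]setTI; exact: measurable_rV_cons.
Qed.

HB.instance Definition _ := isMeasure.Build _ _ _ lebesgue_step
  lebesgue_step0 lebesgue_step_ge0 lebesgue_step_sigma_additive.

Let measurable_rV_uncons :
  measurable_fun [set: 'rV[R]_n.+1]
    (fun x => (x ord0 ord0 : measurableTypeR R, \row_j x ord0 (lift ord0 j))).
Proof.
apply/measurable_fun_pairP; split; first exact: (measurable_rV_coord ord0).
apply/measurable_fun_rV_coordP => i.
rewrite (_ : _ \o _ = rV_coord (lift ord0 i)); first exact: measurable_rV_coord.
by apply/funext => x; rewrite /rV_coord /= mxE.
Qed.

Let lebesgue_step_sigma_finite : sigma_finite setT lebesgue_step.
Proof.
have /sigma_finiteP[F [TF ndF Foo]] := sigma_finiteT (@lebesgue_measure R).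
have /sigma_finiteP[G [TG ndG Goo]] := sigma_finiteT m.
pose g (x : 'rV[R]_n.+1) :=
  (x ord0 ord0 : measurableTypeR R, \row_j x ord0 (lift ord0 j)).
exists (fun k => g @^-1` (F k `*` G k)) => [|k].
  rewrite -preimage_bigcup -(preimage_setT g) -setXTT TF TG; congr preimage.
  rewrite predeqE => -[x y]; split.
    move=> [/= [i _ Fix] [k _ Gky]]; exists (maxn i k) => //; split.
    - by move: x Fix; exact/subsetPset/ndF/leq_maxl.
    - by move: y Gky; exact/subsetPset/ndG/leq_maxr.
  by move=> [i _ []/= ? ?]; split; exists i.
have [mF Fk] := Foo k; have [mG Gk] := Goo k; split.
  rewrite -[X in measurable X]setTI; apply: measurable_rV_uncons => //.
  exact: measurableX.
rewrite /lebesgue_step /pushforward (_ : _ @^-1` _ = F k `*` G k).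
  by rewrite product_measure1E// lte_mul_pinfty// ge0_fin_numE.
rewrite -comp_preimage (_ : _ \o _ = id)//; apply/funext => -[t x].
rewrite /g /=; congr pair; first exact: rV_cons0.
by apply/rowP => j; rewrite mxE rV_consS.
Qed.

HB.instance Definition _ := Measure_isSigmaFinite.Build _ _ _ lebesgue_step
  lebesgue_step_sigma_finite.

End step.

Fixpoint lebesgue_rV n : {sigma_finite_measure set 'rV[R]_n -> \bar R} :=
  if n is n'.+1 then lebesgue_step (lebesgue_rV n')
  else @dirac _ _ (0 : 'rV[R]_0) R.

End lebesgue_rV.

Lemma lebesgue_rV_box (R : realType) n (A : 'I_n -> set (measurableTypeR R)) :
  (forall i, measurable (A i)) ->
  lebesgue_rV n [set x : 'rV[R]_n | forall i, A i (x ord0 i)] =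
  (\prod_(i < n) lebesgue_measure (A i))%E.
Proof.
elim: n A => [|n IHn] A mA.
  by rewrite big_ord0 /= diracE mem_set// => -[].
rewrite big_ord_recl -IHn//= /lebesgue_step /pushforward.
rewrite -product_measure1E//; last first.
  case: n A mA {IHn} => [|n] A mA.
    by rewrite (_ : mkset _ = setT)//; apply/seteqP; split=> // x _ [].
  rewrite (_ : mkset _ =
    \bigcap_(i in [set: 'I_n.+1]) (rV_coord i @^-1` A (lift ord0 i))).
    apply: fin_bigcap_measurable => // i _.
    have := @measurable_rV_coord R _ i measurableT _ (mA (lift ord0 i)).
    by rewrite setTI; apply.
  by apply/seteqP; split=> x /= xA i => [_|]; exact: xA.
congr (product_measure1 _ _ _); apply/seteqP; split=> -[t x] /=.
  by move=> tx; split=> [|i]; [have := tx ord0; rewrite rV_cons0|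
    have := tx (lift ord0 i); rewrite rV_consS].
move=> [tA xA] i; case: (unliftP ord0 i) => [j|] ->.
  by rewrite rV_consS; exact: xA.
by rewrite rV_cons0.
Qed.

Section domain.
Context {R : realType} {n : nat}.
Implicit Types (f : 'rV[R]_n -> R) (Omega : set 'rV[R]_n).

Definition partial (i : 'I_n) f : 'rV[R]_n -> R :=
  fun x => 'D_(delta_mx ord0 i) f x.

(* C^oo: all iterated partial derivatives are differentiable everywhere. *)
Definition smooth f := forall s : seq 'I_n,
  forall x, differentiable (foldr partial f s) x.

(* The norm of 'rV[R]_n in the library is the max norm. *)
Definition enorm (x : 'rV[R]_n) : R := Num.sqrt (\sum_i x ord0 i ^+ 2).

Definition boundary Omega := closure Omega `\` interior Omega.

Definition bdist Omega (x : 'rV[R]_n) : R :=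
  inf [set enorm (x - y) | y in boundary Omega].

End domain.

(* Up to the choice of a coordinate i and of its orientation, Omega lies near
   each of its boundary points strictly above the graph of a smooth function
   of the n - 1 other coordinates. *)
Definition smooth_boundary (R : realType) n (Omega : set 'rV[R]_n) :=
  forall x0, boundary Omega x0 ->
  exists (i : 'I_n) (s : bool) (g : 'rV[R]_n.-1 -> R) (U : set 'rV[R]_n),
    [/\ smooth g, nbhs x0 U &
        Omega `&` U = [set x | g (col' i x) < (-1) ^+ s * x ord0 i] `&` U].

Definition smooth_bounded_domain (R : realType) n (Omega : set 'rV[R]_n) :=
  [/\ Omega !=set0, open Omega, connected Omega, bounded_set Omega &
      smooth_boundary Omega].

(* Functions on Omega are represented by functions on the whole space whose
   values outside Omega are irrelevant. *)
Section sobolev.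
Context {R : realType} {n : nat}.
Variable Omega : set 'rV[R]_n.
Notation mu := (@lebesgue_rV R n).
Implicit Types (u v phi : 'rV[R]_n -> R) (G : 'rV[R]_n -> 'rV[R]_n).

Definition ae_le u v := {ae mu, forall x, Omega x -> (u x <= v x)%R}.

Definition Lp (p : \bar R) u :=
  measurable_fun Omega u /\ finite_norm mu p (u \_ Omega).

Definition dist_L2 u v : \bar R := 'N[mu]_2%:E[EFin \o ((u \- v)%R \_ Omega)]%E.

Definition test_function phi :=
  [/\ smooth phi, compact (closure [set x | phi x != 0]) &
      closure [set x | phi x != 0] `<=` Omega].

Definition weak_gradient u G := forall i,
  Lp 2%:E (fun x => G x ord0 i) /\
  forall phi, test_function phi ->
    (\int[mu]_(x in Omega) (u x * partial i phi x)%:E =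
     - \int[mu]_(x in Omega) (G x ord0 i * phi x)%:E)%E.

Definition H1 u := Lp 2%:E u /\ exists G, weak_gradient u G.

Definition wgrad u : 'rV[R]_n -> 'rV[R]_n :=
  xget (fun=> 0) [set G | weak_gradient u G].

(* H^1_0 is the closure of the test functions in H^1. *)
Definition H10 u := H1 u /\
  exists phi : nat -> 'rV[R]_n -> R,
    [/\ forall k, test_function (phi k),
        dist_L2 (phi k) u @[k --> \oo] --> 0%E &
        forall i, dist_L2 (partial i (phi k)) (fun x => wgrad u x ord0 i)
                    @[k --> \oo] --> 0%E].

(* Extended-real integrals: the integral of the gradients is always finite on
   H^1, hence the equation in weak_solution includes the integrability of
   u^-alpha v. *)
Definition int_grad u v : \bar R :=
  (\int[mu]_(x in Omega)
     (\sum_i wgrad u x ord0 i * wgrad v x ord0 i)%:E)%E.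

(* The power is the real one only where u > 0, which holds a.e. in Omega for
   every function bounded below by a positive multiple of bdist. *)
Definition int_sing (alpha : R) u v : \bar R :=
  (\int[mu]_(x in Omega) (u x `^ (- alpha) * v x)%:E)%E.

Definition subsolution alpha u :=
  [/\ H10 u, Lp +oo%E u & forall v, H10 v -> ae_le (cst 0) v ->
      (int_grad u v - int_sing alpha u v <= 0)%E].

Definition supersolution alpha u :=
  [/\ H10 u, Lp +oo%E u & forall v, H10 v -> ae_le (cst 0) v ->
      (0 <= int_grad u v - int_sing alpha u v)%E].

Definition weak_solution alpha u :=
  H10 u /\ forall v, H10 v -> int_grad u v = int_sing alpha u v.

Definition solution_between alpha u0 u1 u :=
  [/\ weak_solution alpha u, ae_le u0 u & ae_le u u1].

Definition minimal_solution alpha u0 u1 um :=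
  solution_between alpha u0 u1 um /\
  forall u, solution_between alpha u0 u1 u -> ae_le um u.

Definition maximal_solution alpha u0 u1 uM :=
  solution_between alpha u0 u1 uM /\
  forall u, solution_between alpha u0 u1 u -> ae_le u uM.

End sobolev.

(* Main.v *)
Require Import Defs.
From mathcomp Require Import all_boot all_order all_algebra.
From mathcomp Require Import all_classical all_reals all_analysis.
From mathcomp Require Import measurable_realfun ring lra.
Import Order.TTheory GRing.Theory Num.Theory.
Import numFieldNormedType.Exports.
Local Open Scope classical_set_scope.
Local Open Scope ring_scope.

(** Write p for u0. The function s |-> s^-alpha is decreasing, and this yields
    both halves of the theorem.

    Uniqueness. If z and w are two solutions above u0, testing both equations
    with z - w gives that the Dirichlet energy of z - w is the integral of
    (z^-alpha - w^-alpha) (z - w), which is nonpositive; by the Poincare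
    inequality z = w a.e. ([solution_unique]). Hence a solution between u0 and
    u1, once it exists, is at the same time the minimal and the maximal one.

    Existence ([solution_between_exists]). Replace u^-alpha by the truncated
    max(u, p)^-alpha. It is the derivative in u of a concave function, so the
    truncated equation is the Euler equation of a quadratic functional minus a
    concave one, which attains its minimum by the parallelogram law and the
    completeness of H^1_0 ([quadratic_concave_min], [truncated_equation]).
    Testing the truncated equation and the inequality of u1 with the positive
    part of u - u1 gives u <= u1; testing with the positive part of u0 - u gives
    u0 <= u, so that the truncation was not active and u solves the problem.

    The functional makes sense because the integral of p^-alpha |v| is bounded
    by a multiple of the energy norm of v ([singular_weight]): the supersolution
    inequality tested with |v| bounds the integral of u1^-alpha |v|, and
    p >= (c1 / c2) u1 because both functions are comparable to the distance to
    the boundary.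

    The rest is the theory of H^1_0 that this argument uses. The relation
    [strong_grad u G], the closure of the graph of the gradient on test
    functions, is stable under sums, limits and absolute values. It identifies
    H^1_0 together with its gradient ([H10_strong_grad], [strong_grad_H10]),
    because a strong gradient is a weak one (integration by parts, from Fubini
    and the one-dimensional fundamental theorem of calculus) and weak gradients
    are unique a.e. ([fundamental_lemma]). The Poincare inequality comes from
    integrating the partial derivative of x_i phi^2, and |v| is reached through
    the smooth functions sqrt(v^2 + r^2) - r. *)

Set Implicit Arguments.
Unset Strict Implicit.
Unset Printing Implicit Defensive.

(** * Square-integrable functions *)

Lemma discriminant_le {R : realFieldType} (a b c : R) : 0 <= a -> 0 <= c ->
  (forall t, 0 <= a + 2 * t * b + t ^+ 2 * c) -> b ^+ 2 <= a * c.
Proof.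
move=> a0 c0 key; have [cz|cz] := eqVneq c 0.
  have [->|bz] := eqVneq b 0; first by rewrite expr0n mulr_ge0.
  have := key (- (a + 1) / (2 * b)).
  rewrite cz mulr0 addr0.
  have -> : 2 * (- (a + 1) / (2 * b)) * b = - (a + 1) by field.
  lra.
have cp : 0 < c by rewrite lt_def cz.
have := key (- b / c).
have -> : a + 2 * (- b / c) * b + (- b / c) ^+ 2 * c = (a * c - b ^+ 2) / c by field.
by rewrite pmulr_lge0 ?invr_gt0// subr_ge0.
Qed.

Section SquareIntegrable.
Context {d : measure_display} {T : measurableType d} {R : realType}.
Variables (mu : {measure set T -> \bar R}) (D : set T).
Hypothesis mD : measurable D.
Implicit Types (f g h : T -> R).

Notation intbl f := (mu.-integrable D (EFin \o f)).

Definition square_integrable f := measurable_fun D f /\ intbl (fun x => f x ^+ 2).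

Local Notation L2 := square_integrable.

Definition inner f g := \int[mu]_(x in D) (f x * g x).

Local Notation ip := inner.

Lemma intbl_measurable f : intbl f -> measurable_fun D f.
Proof. by move=> /measurable_int /measurable_EFinP. Qed.

Lemma intbl_le f g : measurable_fun D f -> intbl g ->
  (forall x, D x -> `|f x| <= g x) -> intbl f.
Proof.
move=> mf ig fg; apply: le_integrable ig => //; first exact/measurable_EFinP.
move=> x Dx; rewrite /= lee_fin (le_trans (fg x Dx))// ler_norm //.
Qed.

Lemma intblD f g : intbl f -> intbl g -> intbl (fun x => f x + g x).
Proof. by move=> fi gi; exact: integrableD fi gi. Qed.

Lemma intblZ a f : intbl f -> intbl (fun x => a * f x).
Proof. by move=> fi; exact: integrableZl fi. Qed.

Lemma intblB f g : intbl f -> intbl g -> intbl (fun x => f x - g x).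
Proof. by move=> fi gi; exact: integrableB fi gi. Qed.

Lemma L2_mul f g : L2 f -> L2 g -> intbl (fun x => f x * g x).
Proof.
move=> [mf if2] [mg ig2].
apply: (intbl_le _ (intblD if2 ig2)); first exact: measurable_funM.
move=> x _ /=.
have /= := sqr_ge0 (f x - g x); have /= := sqr_ge0 (f x + g x).
rewrite ler_norml sqrrB sqrrD !mulr2n => h1 h2; apply/andP; split; nra.
Qed.

Lemma L2_bnd f h (c : R) : measurable_fun D h -> L2 f ->
  (forall x, D x -> `|h x| <= c * `|f x|) -> L2 h.
Proof.
move=> mh [mf if2] hf; split=> //.
apply: (intbl_le _ (intblZ (c ^+ 2) if2)); first exact: measurable_funX.
move=> x Dx; rewrite normrX -(real_normK (num_real (f x))) -exprMn.
by rewrite lerXn2r// ?nnegrE// (le_trans _ (hf x Dx)).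
Qed.

Lemma L2_mulb f h (c : R) : measurable_fun D h -> L2 f ->
  (forall x, D x -> `|h x| <= c) -> L2 (h * f).
Proof.
move=> mh lf hc; apply: (@L2_bnd f _ c) => //.
  by apply: measurable_funM => //; case: lf.
by move=> x Dx; rewrite normrM ler_wpM2r// hc.
Qed.

Lemma L2_0 : L2 0.
Proof.
split; first exact: measurable_cst.
rewrite (_ : _ \o _ = cst 0%E); first exact: integrable0.
by apply/funext => x /=; rewrite expr0n.
Qed.

Lemma L2D f g : L2 f -> L2 g -> L2 (f + g).
Proof.
move=> lf lg; have [[mf if2] [mg ig2]] := (lf, lg).
split; first exact: measurable_funD.
have := intblD (intblD if2 (intblZ 2 (L2_mul lf lg))) ig2.
by apply: eq_integrable => // x _ /=; congr EFin; rewrite /= sqrrD; lra.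
Qed.

Lemma L2Z a f : L2 f -> L2 (a *: f).
Proof.
move=> [mf if2]; split; first by apply: measurable_funM.
have := intblZ (a ^+ 2) if2.
by apply: eq_integrable => // x _ /=; congr EFin; rewrite -exprMn.
Qed.

Lemma L2N f : L2 f -> L2 (- f).
Proof. by move=> lf; rewrite -scaleN1r; exact: L2Z. Qed.

Lemma L2B f g : L2 f -> L2 g -> L2 (f - g).
Proof. by move=> lf lg; apply: L2D => //; exact: L2N. Qed.

Lemma ipC f g : ip f g = ip g f.
Proof. by apply: eq_Rintegral => x _; rewrite mulrC. Qed.

Lemma ipDl f g h : L2 f -> L2 g -> L2 h -> ip (f + g) h = ip f h + ip g h.
Proof.
move=> lf lg lh; rewrite -RintegralD//; [|exact: L2_mul..].
by apply: eq_Rintegral => x _; rewrite -mulrDl.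
Qed.

Lemma ipZl a f h : L2 f -> L2 h -> ip (a *: f) h = a * ip f h.
Proof.
move=> lf lh; rewrite -RintegralZl//; last exact: L2_mul.
by apply: eq_Rintegral => x _; rewrite mulrA.
Qed.

Lemma ipDr f g h : L2 f -> L2 g -> L2 h -> ip h (f + g) = ip h f + ip h g.
Proof. by move=> *; rewrite ![ip h _]ipC ipDl. Qed.

Lemma ipZr a f h : L2 f -> L2 h -> ip h (a *: f) = a * ip h f.
Proof. by move=> *; rewrite ![ip h _]ipC ipZl. Qed.

Lemma ipNl f h : L2 f -> L2 h -> ip (- f) h = - ip f h.
Proof. by move=> *; rewrite -scaleN1r ipZl// mulN1r. Qed.

Lemma ipBl f g h : L2 f -> L2 g -> L2 h -> ip (f - g) h = ip f h - ip g h.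
Proof. by move=> *; rewrite ipDl ?ipNl//; exact: L2N. Qed.

Lemma ipBr f g h : L2 f -> L2 g -> L2 h -> ip h (f - g) = ip h f - ip h g.
Proof. by move=> *; rewrite ![ip h _]ipC ipBl. Qed.

Lemma ip_ge0 f : 0 <= ip f f.
Proof. by apply: Rintegral_ge0 => x _; rewrite -expr2 sqr_ge0. Qed.

Lemma ipE f : L2 f -> (ip f f)%:E = (\int[mu]_(x in D) (f x ^+ 2)%:E)%E.
Proof.
move=> [mf if2]; rewrite /inner /Rintegral fineK; last exact: integrable_fin_num.
by [].
Qed.

Lemma ip_le f g : L2 f -> L2 g -> (forall x, D x -> `|f x| <= `|g x|) ->
  ip f f <= ip g g.
Proof.
move=> lf lg fg; apply: le_Rintegral => //; [exact: L2_mul..|].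
move=> x Dx; rewrite -!expr2 -(real_normK (num_real (f x))).
by rewrite -(real_normK (num_real (g x))) lerXn2r ?nnegrE// fg.
Qed.

Lemma ip_cs f g : L2 f -> L2 g -> ip f g ^+ 2 <= ip f f * ip g g.
Proof.
move=> lf lg; apply: discriminant_le; [exact: ip_ge0..|move=> t].
have ltg : L2 (t *: g) by exact: L2Z.
have := ip_ge0 (f + t *: g).
have lftg := L2D lf ltg.
by rewrite ipDl// !ipDr// !ipZl// !ipZr// (ipC g f); lra.
Qed.

Lemma ip_sqD f g : L2 f -> L2 g ->
  ip (f + g) (f + g) <= 2 * ip f f + 2 * ip g g.
Proof.
move=> lf lg; have := ip_ge0 (f - g).
have ? := L2D lf lg; have ? := L2B lf lg.
by rewrite ipBl// !ipBr// ipDl// !ipDr// (ipC g f); lra.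
Qed.

Lemma ip_sq_triangle f g h : L2 f -> L2 g -> L2 h ->
  ip (f - h) (f - h) <= 2 * ip (f - g) (f - g) + 2 * ip (g - h) (g - h).
Proof.
move=> lf lg lh; rewrite (_ : f - h = (f - g) + (g - h)); last by rewrite addrA subrK.
by apply: ip_sqD; exact: L2B.
Qed.

Lemma ip_sqZ a f : L2 f -> ip (a *: f) (a *: f) = a ^+ 2 * ip f f.
Proof. by move=> lf; rewrite ipZl ?ipZr//; [rewrite mulrA|exact: L2Z]. Qed.

Lemma ip_sq_subC f g : L2 f -> L2 g -> ip (f - g) (f - g) = ip (g - f) (g - f).
Proof.
move=> lf lg; rewrite -(opprB g f) -scaleN1r ip_sqZ; last exact: L2B.
by rewrite sqrrN expr1n mul1r.
Qed.

Lemma ip_ae f f' g g' : L2 f -> L2 f' -> L2 g -> L2 g' ->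
  {ae mu, forall x, D x -> f x = f' x} ->
  {ae mu, forall x, D x -> g x = g' x} -> ip f g = ip f' g'.
Proof.
move=> lf lf' lg lg' e1 e2; congr fine; apply: ae_eq_integral => //.
- exact: measurable_int (L2_mul lf lg).
- exact: measurable_int (L2_mul lf' lg').
- by apply: filterS2 e1 e2 => x fx gx Dx; rewrite fx// gx.
Qed.

Lemma ip_sq_ae0 f : L2 f -> {ae mu, forall x, D x -> f x = 0} -> ip f f = 0.
Proof.
move=> lf f0; rewrite (ip_ae lf L2_0 lf L2_0 f0 f0).
by rewrite /inner; under eq_Rintegral do rewrite mul0r; rewrite Rintegral_cst// mul0r.
Qed.

Lemma ip_sq0_ae f : L2 f -> ip f f = 0 -> {ae mu, forall x, D x -> f x = 0}.
Proof.
move=> lf f0.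
have mf2 : measurable_fun D (fun x => (f x ^+ 2)%:E).
  by apply/measurable_EFinP/measurable_funX; case: lf.
have /ae_eq_integral_abs : (\int[mu]_(x in D) `|(f x ^+ 2)%:E| = 0)%E.
  rewrite -[RHS](_ : (ip f f)%:E = _) ?f0// -?f0// ipE//.
  by apply: eq_integral => x _; rewrite gee0_abs// lee_fin sqr_ge0.
move=> /(_ mD mf2); apply: filterS => x /= /[apply] /eqP.
by rewrite eqe expf_eq0 => /eqP.
Qed.

Lemma integral_powR2 f : (\int[mu]_x (`|(EFin \o (f \_ D)) x| `^ 2) =
  \int[mu]_(x in D) (f x ^+ 2)%:E)%E.
Proof.
rewrite [RHS]integral_mkcond; apply: eq_integral => x _ /=.
rewrite !patchE; case: ifPn => _.
  by rewrite powR_mulrn ?real_normK ?num_real.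
by rewrite /point /= normr0 powR0.
Qed.

Lemma Lnorm2_eq f : L2 f ->
  'N[mu]_2%:E[EFin \o (f \_ D)]%E = (Num.sqrt (ip f f))%:E.
Proof.
move=> lf; rewrite unlock /Lnorm integral_powR2 -ipE//.
by rewrite poweR_EFin powR12_sqrt// ip_ge0.
Qed.

Lemma finite_norm_L2 f : measurable_fun D f ->
  finite_norm mu 2%:E (f \_ D) <-> L2 f.
Proof.
move=> mf; split=> [nf|lf]; last by rewrite /finite_norm Lnorm2_eq// ltry.
split=> //; apply/integrableP; split.
  exact/measurable_EFinP/measurable_funX.
have e2 : (2 : R) != 0 by [].
have := @powR_Lnorm _ _ _ mu (EFin \o (f \_ D)) _ e2.
rewrite integral_powR2 => e.
under eq_integral do rewrite gee0_abs ?lee_fin ?sqr_ge0//.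
by rewrite -e poweR_lty.
Qed.

(** With weights 2^k the arithmetic-geometric inequality bounds the increment
    |f_(k+1) - f_k| by 2^-k + 2^k (f_(k+1) - f_k)^2. By the hypothesis the second
    terms have a sum with finite integral, hence finite a.e., so the increments
    are absolutely summable a.e. *)
Lemma L2_cvg_sub (f : nat -> T -> R) :
  (forall k, L2 (f k)) ->
  (forall k, ip (f k.+1 - f k) (f k.+1 - f k) <= (8 ^- k)) ->
  exists g, measurable_fun D g /\
    {ae mu, forall x, D x -> f k x @[k --> \oo] --> g x}.
Proof.
move=> lf fs.
(* The integral of [h k] is at most 2^k 8^-k = 4^-k. *)
pose h k x : R := 2 ^+ k * (f k.+1 x - f k x) ^+ 2.
have mh k : measurable_fun D (h k).
  apply: measurable_funM => //; apply/measurable_funX/measurable_funB; by case: (lf k); case: (lf k.+1).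
have h0 k x : 0 <= h k x by rewrite /h mulr_ge0 ?sqr_ge0// exprn_ge0.
have ih : (\int[mu]_(x in D) \sum_(k <oo) (h k x)%:E < +oo)%E.
  rewrite integral_nneseries//; last 2 first.
  - by move=> k; exact/measurable_EFinP.
  - by move=> k x _; rewrite lee_fin.
  apply: (@le_lt_trans _ _ (\sum_(k <oo) (geometric 1 (4^-1 : R) k)%:E)%E).
    apply: lee_nneseries => [k _ _|k _]; first by apply: integral_ge0 => x _; rewrite lee_fin.
    under eq_integral do rewrite EFinM.
    rewrite integralZl//; last by case: (L2B (lf k.+1) (lf k)).
    rewrite -[X in (_ * X)%E](ipE (L2B (lf k.+1) (lf k))) lee_fin /= mul1r.
    rewrite (le_trans (ler_wpM2l _ (fs k)))// ?exprn_ge0//.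
    by rewrite -exprVn -exprMn lerXn2r ?nnegrE//; lra.
  have c4 : `|4^-1 : R| < 1 by rewrite ger0_norm//; lra.
  rewrite (_ : \sum_(k <oo) _ = (limn (series (geometric 1 (4^-1 : R))))%:E)%E ?ltry//.
  rewrite -EFin_lim; last exact: is_cvg_geometric_series.
  apply/congr_lim/funext => k /=.
  by rewrite sumEFin.
have mS : measurable_fun D (fun x => \sum_(k <oo) (h k x)%:E)%E.
  apply: ge0_emeasurable_sum => [k x _ _|k _]; first by rewrite lee_fin.
  exact/measurable_EFinP.
have iS : mu.-integrable D (fun x => \sum_(k <oo) (h k x)%:E)%E.
  apply/integrableP; split=> //; under eq_integral.
    move=> x _; rewrite gee0_abs; last by apply: nneseries_ge0 => k _ _; rewrite lee_fin.
    over.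
  by [].
(* The superior limit is measurable without knowing where the limit exists. *)
exists (fun x => fine (limn_esup (fun k => (f k x)%:E))); split.
  apply: measurableT_comp; first exact: fine_measurable.
  by apply: measurable_fun_limn_esup => k; apply/measurable_EFinP; case: (lf k).
have := integrable_ae mD iS; apply: filterS => x /[apply] Sx.
have ch : cvgn (series (h ^~ x)).
  apply: nondecreasing_is_cvgn.
    by apply: nondecreasing_series => k _ _.
  exists (fine (\sum_(k <oo) (h k x)%:E)%E) => _ [n _ <-].
  rewrite -lee_fin fineK// /series /= -sumEFin.
  by apply: nneseries_lim_ge => k _ _; rewrite lee_fin.
have cd : cvgn (series (fun k => f k.+1 x - f k x)).
  apply: normed_cvg.
  apply: (@series_le_cvg _ _ (fun k => geometric 1 (2^-1 : R) k + h k x)) => //.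
  - by move=> k; exact: normr_ge0.
  - by move=> k; rewrite addr_ge0//= mul1r exprn_ge0// invr_ge0.
  - move=> k /=; rewrite mul1r /h; set a := f k.+1 x - f k x.
    have p2 : 0 < (2 : R) ^+ k by rewrite exprn_gt0.
    rewrite -[a ^+ 2]real_normK ?num_real// exprVn.
    have := sqr_ge0 (1 - 2 ^+ k * `|a|).
    rewrite -(@pmulr_rge0 _ (2 ^+ k)^-1) ?invr_gt0//.
    rewrite (_ : _ * _ = (2 ^+ k)^-1 + 2 ^+ k * `|a| ^+ 2 - 2 * `|a|); last first.
      by field; rewrite gt_eqF.
    by have := normr_ge0 a; lra.
  rewrite (_ : series _ = series (geometric 1 2^-1) \+ series (h ^~ x)); last first.
    by apply/funext => n; rewrite /series /= big_split.
  apply: is_cvgD => //; apply: is_cvg_geometric_series.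
  by rewrite ger0_norm//; lra.
have cf : cvgn (f ^~ x).
  have -> : f ^~ x = (fun n => f 0%N x + series (fun k => f k.+1 x - f k x) n).
    apply/funext => n; rewrite /series /= telescope_sumr//.
    by rewrite addrC subrK.
  by apply: is_cvgD => //; exact: is_cvg_cst.
have /cvg_limn_einf_sup[_ ->] : (f k x)%:E @[k --> \oo] --> (limn (f ^~ x))%:E.
  by apply/fine_cvgP; split; [exact: nearW|].
exact: cf.
Qed.

Lemma fatou_le (f : nat -> T -> R) g (e : R) :
  (forall k, measurable_fun D (f k)) -> measurable_fun D g ->
  (forall k x, 0 <= f k x) -> (forall x, 0 <= g x) ->
  {ae mu, forall x, D x -> f k x @[k --> \oo] --> g x} ->
  (exists K, forall k, (K <= k)%N -> (\int[mu]_(x in D) (f k x)%:E <= e%:E)%E) ->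
  (\int[mu]_(x in D) (g x)%:E <= e%:E)%E.
Proof.
move=> mf mg f0 g0 fg [K HK].
have mlim : measurable_fun D (fun x => limn_einf (fun j => (f j x)%:E)).
  rewrite (_ : (fun x => _) =
      (fun x => - limn_esup (-%E \o (fun j => (f j x)%:E)))%E); last first.
    by apply/funext => x; rewrite limn_esupN oppeK.
  apply: measurableT_comp; first exact: oppe_measurable.
  apply: (@measurable_fun_limn_esup _ _ _ _ (fun j x => - (f j x)%:E)%E) => j.
  by apply: measurableT_comp; [exact: oppe_measurable|exact/measurable_EFinP].
rewrite (_ : (\int[mu]_(x in D) (g x)%:E =
    \int[mu]_(x in D) limn_einf (fun j => (f j x)%:E))%E); last first.
  apply: ge0_ae_eq_integral => //.
  - exact/measurable_EFinP.
  - by move=> x _; rewrite lee_fin.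
  - move=> x _; rewrite limn_einf_lim; apply: lime_ge; first exact: is_cvg_einfs.
    by apply: nearW => k; apply: le_ereal_inf_tmp => _ [m _ <-]; rewrite lee_fin.
  - apply: filterS fg => x /[apply] fgx; apply/esym.
    have /cvg_limn_einf_sup[-> _] // : ((f j x)%:E @[j --> \oo] --> (g x)%:E)%E.
    by apply: cvg_EFin; [exact: nearW|exact: fgx].
apply: le_trans (fatou _ _ _ _) _ => //.
- by move=> k; exact/measurable_EFinP.
- by move=> k x _; rewrite lee_fin.
rewrite limn_einf_lim; apply: lime_le; first exact: is_cvg_einfs.
apply: nearW => k; apply: (@le_trans _ _ (\int[mu]_(x in D) (f (maxn k K) x)%:E)%E).
  by apply: ereal_inf_lbound; exists (maxn k K) => //=; exact: leq_maxl.
by apply: HK; exact: leq_maxr.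
Qed.

(** A rapidly converging subsequence has an a.e. limit; Fatou's lemma along the
    subsequence then bounds the distance of each term to that limit. *)
Lemma L2_complete (f : nat -> T -> R) : (forall k, L2 (f k)) ->
  (forall e : R, 0 < e -> exists K, forall j k, (K <= j)%N -> (K <= k)%N ->
    ip (f j - f k) (f j - f k) < e) ->
  exists g, L2 g /\ forall e : R, 0 < e -> exists K, forall k, (K <= k)%N ->
    ip (f k - g) (f k - g) < e.
Proof.
move=> lf cf.
have /choice[N HN] : forall i, exists K, forall j k, (K <= j)%N -> (K <= k)%N ->
    ip (f j - f k) (f j - f k) < 8 ^- i by move=> i; apply: cf; rewrite invr_gt0 exprn_gt0.
(* Summing the thresholds makes the subsequence monotone. *)
pose n k := (k + \sum_(i < k.+1) N i)%N.
have nN k : (N k <= n k)%N by rewrite /n big_ord_recr/= addnA leq_addl.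
have nk k : (k <= n k)%N by rewrite /n leq_addr.
have nS k : (n k <= n k.+1)%N.
  by rewrite [n k.+1]/n big_ord_recr leq_add// leq_addr.
have [g [mg fg]] : exists g, measurable_fun D g /\
    {ae mu, forall x, D x -> f (n k) x @[k --> \oo] --> g x}.
  apply: L2_cvg_sub => k; first exact: lf.
  by apply/ltW/HN => //; rewrite (leq_trans (nN k)).
have key (e : R) : 0 < e -> exists K, forall k, (K <= k)%N ->
    (\int[mu]_(x in D) ((f k x - g x) ^+ 2)%:E <= e%:E)%E.
  move=> e0; have [K HK] := cf _ e0; exists K => k Kk.
  apply: (@fatou_le (fun j x => (f k x - f (n j) x) ^+ 2)).
  - by move=> j; apply/measurable_funX/measurable_funB; case: (lf k); case: (lf (n j)).
  - by apply/measurable_funX/measurable_funB => //; case: (lf k).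
  - by move=> j x; exact: sqr_ge0.
  - by move=> x; exact: sqr_ge0.
  - apply: filterS fg => x /[apply] fgx.
    under eq_fun do rewrite expr2.
    by rewrite expr2; apply: cvgM; apply: cvgB => //; exact: cvg_cst.
  - exists K => j Kj; rewrite -(ipE (L2B (lf k) (lf (n j)))) lee_fin.
    by apply/ltW/HK => //; rewrite (leq_trans Kj).
have lfg (e : R) : 0 < e -> exists K, forall k, (K <= k)%N -> L2 (f k - g) /\
    ip (f k - g) (f k - g) <= e.
  move=> e0; have [K HK] := key _ e0; exists K => k Kk.
  have lfkg : L2 (f k - g).
    have mfg : measurable_fun D (f k - g) by apply: measurable_funB => //; case: (lf k).
    split=> //; apply/integrableP; split; first exact/measurable_EFinP/measurable_funX.
    under eq_integral do rewrite gee0_abs ?lee_fin ?sqr_ge0//.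
    by rewrite (le_lt_trans (HK k Kk))// ltry.
  by split => //; rewrite -lee_fin ipE//; exact: HK.
exists g; split.
  have [K /(_ _ (leqnn K))[lK _]] := lfg _ ltr01.
  by rewrite -(subKr (f K) g); exact: L2B.
move=> e e0; have [|K HK] := lfg (e / 2); first by rewrite divr_gt0.
exists K => k /HK[_ h]; rewrite (le_lt_trans h)//.
by rewrite ltr_pdivrMr// ltr_pMr// ltr1n.
Qed.

Lemma L2_dominated_cvg (f : nat -> T -> R) g h :
  (forall k, measurable_fun D (f k)) -> measurable_fun D g -> L2 h ->
  (forall k x, D x -> `|f k x| <= `|h x|) ->
  (forall x, D x -> f k x @[k --> \oo] --> g x) ->
  L2 g /\ forall e : R, 0 < e -> \forall k \near \oo, ip (f k - g) (f k - g) < e.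
Proof.
move=> mf mg lh fh fg.
have gh x : D x -> `|g x| <= `|h x|.
  move=> Dx; have fgx := fg x Dx.
  rewrite -(cvg_lim _ (cvg_norm fgx))//; apply: limr_le.
    by apply/cvg_ex; exists `|g x|; exact: cvg_norm.
  by apply: nearW => k; exact: fh.
have lg : L2 g.
  by apply: (@L2_bnd h _ 1) => // x Dx; rewrite mul1r gh.
split=> // e e0.
have lf k : L2 (f k) by apply: (@L2_bnd h _ 1) => // x Dx; rewrite mul1r fh.
have [] := @dominated_convergence _ _ _ mu D mD
  (fun k x => ((f k x - g x) ^+ 2)%:E) (cst 0%E) (fun x => (4 * h x ^+ 2)%:E).
- by move=> k; apply/measurable_EFinP/measurable_funX/measurable_funB.
- exact: measurable_cst.
- apply: aeW => x Dx; apply: cvg_EFin; first exact: nearW.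
  rewrite [X in _ --> X](_ : _ = (g x - g x) * (g x - g x)); last by rewrite subrr mulr0.
  rewrite [X in X @ _](_ : _ = fun k => (f k x - g x) * (f k x - g x)); last first.
    by apply/funext => k /=; rewrite expr2.
  by apply: cvgM; apply: cvgB; [exact: fg|exact: cvg_cst|exact: fg|exact: cvg_cst].
- by apply: intblZ; case: lh.
- apply: aeW => x k Dx; rewrite gee0_abs ?lee_fin ?sqr_ge0//.
  rewrite -(real_normK (num_real (f k x - g x))) -(real_normK (num_real (h x))).
  rewrite (_ : 4 * _ = (2 * `|h x|) ^+ 2); last by ring.
  rewrite lerXn2r ?nnegrE ?mulr_ge0// (le_trans (ler_normB _ _))//.
  by rewrite mulr_natl mulr2n lerD// ?fh// gh.
move=> _ _; rewrite integral0 => /fine_cvgP[_] /cvgrPdist_lt /(_ _ e0) h1.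
apply: filterS h1 => k /=; rewrite sub0r normrN; apply: le_lt_trans.
by rewrite (le_trans _ (ler_norm _))// -[leLHS]/(fine (ip _ _)%:E) ipE//; exact: L2B.
Qed.

End SquareIntegrable.

(** * Row space: Borel sets, smooth functions, test functions *)

Section RowSpace.
Context {R : realType} {n : nat}.
Implicit Types (f g : 'rV[R]_n -> R) (x : 'rV[R]_n).

(** Countably many cubes with rational centres form a base of the topology: this
    is what makes open sets Borel, and makes a.e. statements local. *)
Lemma rational_cube (U : set 'rV[R]_n) x : open U -> U x ->
  exists (q : 'rV[rat]_n) (k : nat),
    (forall i, `|ratr (q ord0 i) - x ord0 i| < k.+1%:R^-1) /\
    forall y : 'rV[R]_n, (forall i, `|ratr (q ord0 i) - y ord0 i| <= k.+1%:R^-1) -> U y.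
Proof.
move=> oU Ux; have /nbhs_ballP[e /= e0 xeU] := open_nbhs_nbhs (conj oU Ux).
have [k ke] : exists k : nat, 2 / k.+1%:R < e.
  exists (Num.truncn (2 / e)); rewrite ltr_pdivrMr// -ltr_pdivrMl// mulrC.
  exact: truncnS_gt.
have k0 : 0 < k.+1%:R^-1 :> R by rewrite invr_gt0.
have /choice[q qP] : forall i, exists q : rat, `|ratr q - x ord0 i| < k.+1%:R^-1.
  move=> i; have [|q] := @rat_in_itvoo R (x ord0 i - k.+1%:R^-1) (x ord0 i + k.+1%:R^-1).
    by rewrite ltrD2l (lt_trans _ k0)// oppr_lt0.
  by rewrite in_itv /= => /andP[q1 q2]; exists q; rewrite ltr_distl q1 q2.
exists (\row_i q i), k; split=> [i|y qy]; first by rewrite mxE.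
apply: xeU; split => // i j; rewrite (ord1 i) /ball /=.
have := qy j; have := qP j; rewrite mxE /= => h1 h2.
rewrite (lt_le_trans _ (ltW ke))// mulrDl !mul1r.
by rewrite (le_lt_trans (ler_distD (ratr (q j)) _ _))// ltr_leD// distrC.
Qed.

Lemma open_measurable_rV (U : set 'rV[R]_n) : open U -> measurable U.
Proof.
move=> oU.
pose B (q : 'rV[rat]_n * nat) : set 'rV[R]_n :=
  [set x | forall i, `|ratr (q.1 ord0 i) - x ord0 i| < q.2.+1%:R^-1].
pose F q := if `[< B q `<=` U >] then B q else set0.
have mB q : measurable (B q).
  rewrite (_ : B q = \bigcap_(i in [set: 'I_n])
      (rV_coord i @^-1` ball (ratr (q.1 ord0 i) : R) q.2.+1%:R^-1)); last first.
    by apply/seteqP; split=> [x Bx i _|x Bx i]; [exact: Bx|exact: (Bx i)].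
  apply: fin_bigcap_measurable => // i _; rewrite -[X in measurable X]setTI.
  by apply: measurable_rV_coord => //; exact: measurable_ball.
rewrite (_ : U = \bigcup_q F q).
  apply: countable_bigcupT_measurable => // q; rewrite /F; case: ifPn => // _.
apply/seteqP; split=> [x Ux|x [q _]]; last first.
  by rewrite /F; case: ifPn => // /asboolP + Bx; apply.
have [q [k [qx qU]]] := rational_cube oU Ux.
exists (q, k) => //; rewrite /F ifT//; apply/asboolP => y Bqy.
by apply: qU => i; apply/ltW/Bqy.
Qed.

Lemma continuous_measurable_rV f : continuous f -> measurable_fun [set: 'rV[R]_n] f.
Proof.
move=> cf; apply: (measurability _ (RGenOpens.measurableE R)).
move=> _ [_ [a [b ->]] <-]; rewrite setTI.
apply: open_measurable_rV; apply: open_comp => //.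
Qed.

Lemma coord_le_norm x i : `|x ord0 i| <= `|x|.
Proof.
rewrite [leRHS]/Num.norm /= mx_normrE.
by rewrite (le_bigmax _ (fun ij => `|x ij.1 ij.2|) (ord0, i)).
Qed.

Definition cube (M : R) : set 'rV[R]_n := [set x | forall i, x ord0 i \in `[-M, M]].

Lemma measurable_cube M : measurable (cube M).
Proof.
rewrite (_ : cube M = \bigcap_(i in [set: 'I_n]) (rV_coord i @^-1` `[-M, M])).
  apply: fin_bigcap_measurable => // i _; rewrite -[X in measurable X]setTI.
  by apply: measurable_rV_coord => //; exact: measurable_itv.
by apply/seteqP; split=> [x Bx i _|x Bx i]; [exact: Bx|exact: (Bx i)].
Qed.

Lemma cube_measure_lty M : (lebesgue_rV n (cube M) < +oo)%E.
Proof.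
rewrite (@lebesgue_rV_box R n (fun=> `[-M, M]%classic)); last by move=> i; exact: measurable_itv.
set P := (X in (X < _)%E); suff /andP[] : ((0 <= P) && (P < +oo))%E by [].
rewrite {}/P; elim/big_ind: _ => [|a b /andP[a0 aoo] /andP[b0 boo]|i _].
- by rewrite lee01 ltry.
- by rewrite mule_ge0// lte_mul_pinfty// ge0_fin_numE.
- by rewrite measure_ge0/= lebesgue_measure_itv; case: ifP => _; rewrite ?ltry.
Qed.

Lemma bounded_sub_cube (A : set 'rV[R]_n) : bounded_set A ->
  exists M, 0 < M /\ A `<=` cube M.
Proof.
move=> [M [_ AM]]; exists (`|M| + 1); split; first by rewrite ltr_wpDl.
move=> x Ax i; rewrite in_itv /= -ler_norml.
apply: (le_trans (coord_le_norm x i)); apply: AM => //.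
by rewrite (le_lt_trans (ler_norm M))// ltrDl.
Qed.

(** The algebra generated by [A]. If [A] consists of differentiable functions
    whose partial derivatives lie in this algebra, then so do all iterated
    partial derivatives; smoothness is thereby proved by exhibiting a family
    closed under one differentiation. *)
Inductive generated (A : set ('rV[R]_n -> R)) : set ('rV[R]_n -> R) :=
| generated_base f : A f -> generated A f
| generatedD f g : generated A f -> generated A g -> generated A (f + g)
| generatedM f g : generated A f -> generated A g -> generated A (f * g).

Lemma partialD i f g x : differentiable f x -> differentiable g x ->
  partial i (f + g) x = partial i f x + partial i g x.
Proof. by move=> df dg; rewrite /partial deriveD//; exact: diff_derivable. Qed.

Lemma partialM i f g x : differentiable f x -> differentiable g x ->
  partial i (f * g) x = f x * partial i g x + g x * partial i f x.
Proof. by move=> df dg; rewrite /partial deriveM//; exact: diff_derivable. Qed.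

Lemma generated_smooth (A : set ('rV[R]_n -> R)) :
  (forall f, A f -> (forall x, differentiable f x) /\
     forall i, generated A (partial i f)) ->
  forall f, generated A f -> smooth f.
Proof.
move=> AP.
have dA f : generated A f -> forall x, differentiable f x.
  elim=> [{}f /AP[]//|{}f g _ df _ dg x|{}f g _ df _ dg x].
    exact: differentiableD.
  exact: differentiableM.
have pA f : generated A f -> forall i, generated A (partial i f).
  elim=> [{}f /AP[]//|{}f g Af pf Ag pg i|{}f g Af pf Ag pg i].
    rewrite (_ : partial i _ = partial i f + partial i g).
      exact: generatedD.
    by apply/funext => x; rewrite partialD//; exact: dA.
  rewrite (_ : partial i _ = f * partial i g + g * partial i f).
    by apply: generatedD; exact: generatedM.
  by apply/funext => x; rewrite partialM//; exact: dA.
move=> f Af s; suff : generated A (foldr partial f s) by move/dA.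
by elim: s => //= i s IHs; exact: pA.
Qed.

Lemma smooth_partial i f : smooth f -> smooth (partial i f).
Proof. by move=> sf s; have := sf (rcons s i); rewrite foldr_rcons. Qed.

Lemma smooth_diff f x : smooth f -> differentiable f x.
Proof. by move=> sf; exact: (sf [::]). Qed.

Lemma smooth_continuous f : smooth f -> continuous f.
Proof. by move=> sf x; apply: differentiable_continuous; exact: smooth_diff. Qed.

Let smooth_generated f : generated (@smooth R n) f -> smooth f.
Proof.
apply: generated_smooth => {}f sf; split=> [x|i]; first exact: smooth_diff.
by apply: generated_base; exact: smooth_partial.
Qed.

Lemma smoothD f g : smooth f -> smooth g -> smooth (f + g).
Proof.
by move=> sf sg; apply/smooth_generated/generatedD; exact: generated_base.
Qed.

Lemma smoothM f g : smooth f -> smooth g -> smooth (f * g).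
Proof.
by move=> sf sg; apply/smooth_generated/generatedM; exact: generated_base.
Qed.

Lemma smooth_cst (c : R) : smooth (cst c : 'rV[R]_n -> R).
Proof.
apply: (@generated_smooth [set f | exists c, f = cst c]); last first.
  by apply: generated_base; exists c.
move=> _ [{}c ->]; split=> [x|i]; first exact: differentiable_cst.
by apply: generated_base; exists 0; apply/funext => x; rewrite /partial derive_cst.
Qed.

Lemma partial_coord i j x :
  partial i (fun y : 'rV[R]_n => y ord0 j) x = (i == j)%:R.
Proof.
rewrite /partial /derive; set D := fun h => _.
suff -> : lim (D h @[h --> 0^']) = (i == j)%:R by [].
apply: cvg_lim => //; apply: cvg_near_cst; near=> h.
rewrite /D /= !mxE eqxx /= addrK -[_ *: _]/(_ * _) mulrC -mulrA.
have h0 : h != 0 by near: h; exact: nbhs_dnbhs_neq.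
by rewrite eq_sym mulrC divfK.
Unshelve. all: by end_near. Qed.

Lemma differentiable_compR f (h : R -> R) (h' : R) x :
  differentiable f x -> is_derive (f x) 1 h h' -> differentiable (h \o f) x.
Proof.
by move=> df [dh _]; apply: differentiable_comp => //; apply/derivable1_diffP.
Qed.

Lemma partial_comp i f (h : R -> R) (h' : R) x :
  differentiable f x -> is_derive (f x) 1 h h' ->
  partial i (h \o f) x = h' * partial i f x.
Proof.
move=> df dh; have dhf := differentiable_compR df dh.
case: dh => dh <-; have dh1 : differentiable h (f x) by apply/derivable1_diffP.
rewrite /partial deriveE// diff_comp// deriveE//= deriv1E//.
by rewrite scale1r [in RHS]deriveE// mulrC.
Qed.

Lemma smooth_coord j : smooth (fun x : 'rV[R]_n => x ord0 j).
Proof.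
apply: (@generated_smooth ([set f | f = fun x => x ord0 j] `|` @smooth R n)).
  move=> f [->|sf]; split=> [x|i].
  - exact: differentiable_coord.
  - apply: generated_base; right.
    rewrite (_ : partial i _ = cst (i == j)%:R); first exact: smooth_cst.
    by apply/funext => x; rewrite partial_coord.
  - exact: smooth_diff.
  - by apply: generated_base; right; exact: smooth_partial.
by apply: generated_base; left.
Qed.

Lemma smoothZ (c : R) f : smooth f -> smooth (c *: f).
Proof. by move=> sf; apply: (smoothM (smooth_cst c) sf). Qed.

Lemma smooth_prod (I : Type) (r : seq I) (F : I -> 'rV[R]_n -> R) :
  (forall i, smooth (F i)) -> smooth (fun x => \prod_(i <- r) F i x).
Proof.
move=> sF; elim: r => [|i r IH].
  rewrite (_ : (fun x => _) = cst 1); first exact: smooth_cst.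
  by apply/funext => x; rewrite big_nil.
rewrite (_ : (fun x => _) = F i * (fun x => \prod_(i <- r) F i x)).
  exact: smoothM.
by apply/funext => x; rewrite big_cons.
Qed.

(** The chain rule stays in the algebra generated by the [h k \o f] and the
    smooth functions. *)
Lemma smooth_compo (h : nat -> R -> R) f :
  (forall k (t : R), is_derive t 1 (h k) (h k.+1 t)) -> smooth f ->
  smooth (h 0%N \o f).
Proof.
move=> hP sf.
apply: (@generated_smooth ([set g | exists k, g = h k \o f] `|` @smooth R n)).
  move=> g [[k ->]|sg]; split=> [x|i].
  - exact: differentiable_compR (smooth_diff x sf) (hP k (f x)).
  - rewrite (_ : partial i _ = (h k.+1 \o f) * partial i f).
      apply: generatedM; apply: generated_base; first by left; exists k.+1.
      by right; exact: smooth_partial.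
    by apply/funext => x; rewrite (partial_comp i (smooth_diff x sf) (hP k (f x))).
  - exact: smooth_diff.
  - by apply: generated_base; right; exact: smooth_partial.
by apply: generated_base; left; exists 0%N.
Qed.

Lemma partial_sqrt i f x : smooth f -> 0 < f x ->
  partial i (Num.sqrt \o f) x = (2 * Num.sqrt (f x))^-1 * partial i f x.
Proof.
move=> sf f0; apply: partial_comp; first exact: smooth_diff.
exact: is_derive1_sqrt.
Qed.

(** The inverse root r satisfies the differential equation
    r' = - 1/2 r^3 f', hence is smooth, and sqrt f = f r. *)
Lemma smooth_sqrt f : smooth f -> (forall x, 0 < f x) -> smooth (Num.sqrt \o f).
Proof.
move=> sf f0; pose r x := (Num.sqrt (f x))^-1.
have s0 x : Num.sqrt (f x) != 0 by rewrite gt_eqF// sqrtr_gt0.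
have ds x : differentiable (Num.sqrt \o f) x.
  exact: differentiable_compR (smooth_diff x sf) (is_derive1_sqrt (f0 x)).
have dr x : differentiable r x by exact: differentiableV.
have pr i x : partial i r x = - 2^-1 * r x ^+ 3 * partial i f x.
  rewrite [LHS]/partial deriveV//; last exact: diff_derivable.
  rewrite -/(partial i (Num.sqrt \o f) x) partial_sqrt// /r -[_ *: _]/(_ * _) /=.
  by field.
pose C := [set g | g = r] `|` @smooth R n.
have gr : generated C r by apply: generated_base; left.
have gs g : smooth g -> generated C g by move=> sg; apply: generated_base; right.
have smr : smooth r.
  apply: (@generated_smooth C) => // g [->|sg]; split=> [x|i].
  - exact: dr.
  - rewrite (_ : partial i r = (cst (- 2^-1)) * (r * (r * r)) * partial i f).
      apply: generatedM; last exact/gs/smooth_partial.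
      apply: generatedM; first exact/gs/smooth_cst.
      by apply: generatedM => //; exact: generatedM.
    by apply/funext => x; rewrite pr !fctE /=; ring.
  - exact: smooth_diff.
  - exact/gs/smooth_partial.
rewrite (_ : _ \o _ = f * r); first exact: smoothM.
apply/funext => x; rewrite [RHS](_ : _ = Num.sqrt (f x) ^+ 2 * (Num.sqrt (f x))^-1).
  by rewrite expr2 mulfK.
by rewrite sqr_sqrtr// ltW.
Qed.

End RowSpace.

Section TestFunctions.
Context {R : realType} {n : nat}.
Variable Omega : set 'rV[R]_n.
Implicit Types (f g phi psi : 'rV[R]_n -> R).

Lemma test_function_support f (K : set 'rV[R]_n) : smooth f -> compact K ->
  K `<=` Omega -> (forall x, f x != 0 -> K x) -> test_function Omega f.
Proof.
move=> sf cK KO fK.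
have cl : closed K by apply: compact_closed => //; exact: norm_hausdorff.
have fK' : closure [set x | f x != 0] `<=` K.
  by rewrite [X in _ `<=` X](closure_id K).1//; apply: closure_subset => x /fK.
split=> //; last exact: subset_trans KO.
by apply: subclosed_compact cK fK'; exact: closed_closure.
Qed.

Lemma test_function_sub f phi : test_function Omega phi -> smooth f ->
  (forall x, f x != 0 -> closure [set x | phi x != 0] x) -> test_function Omega f.
Proof.
by move=> [_ cphi phiO] sf fphi; exact: test_function_support cphi phiO fphi.
Qed.

Lemma test_smooth phi : test_function Omega phi -> smooth phi.
Proof. by case. Qed.

Lemma test_out phi x : test_function Omega phi -> ~ Omega x -> phi x = 0.
Proof.
move=> [_ _ phiO] Ox; apply/eqP; apply: contrapT => /negP h.
by apply/Ox/phiO; exact: subset_closure.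
Qed.

Lemma test_partial i phi : test_function Omega phi -> test_function Omega (partial i phi).
Proof.
move=> tphi; apply: (test_function_sub tphi); first exact/smooth_partial/test_smooth.
move=> x; apply: contraPP => nx; apply/negP; rewrite negbK; apply/eqP.
have op : open (~` closure [set x | phi x != 0]).
  by apply: closed_openC; exact: closed_closure.
rewrite /partial (@near_eq_derive _ _ _ phi (cst 0)) ?derive_cst//.
apply: filterS (open_nbhs_nbhs (conj op nx)) => y /= ny.
by apply/eqP; apply: contrapT => /negP h; apply: ny; exact: subset_closure.
Qed.

Lemma test_Ml f phi : test_function Omega phi -> smooth f -> test_function Omega (f * phi).
Proof.
move=> tphi sf; apply: (test_function_sub tphi).
  by apply: smoothM => //; exact: test_smooth tphi.
by move=> x; rewrite mulf_eq0 negb_or => /andP[_ h]; exact: subset_closure.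
Qed.

Lemma test_Z c phi : test_function Omega phi -> test_function Omega (c *: phi).
Proof. by move=> tphi; apply: (test_Ml tphi (@smooth_cst R n c)). Qed.

Lemma test_D phi psi : test_function Omega phi -> test_function Omega psi ->
  test_function Omega (phi + psi).
Proof.
move=> [s1 c1 o1] [s2 c2 o2].
apply: (test_function_support (smoothD s1 s2) (compactU c1 c2)).
  by move=> x [/o1|/o2].
move=> x h; have [p1|p1] := eqVneq (phi x) 0; last by left; exact: subset_closure.
right; apply: subset_closure => /=; move: h; rewrite !fctE p1 add0r//.
Qed.

Lemma test_0 : test_function Omega 0.
Proof.
apply: (@test_function_support _ set0) => //; [|exact: compact0|by move=> x; rewrite eqxx].
exact: smooth_cst.
Qed.

Lemma test_bounded phi : test_function Omega phi -> exists M, forall x, `|phi x| <= M.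
Proof.
move=> tphi; have [sphi cK _] := tphi.
have cphi := smooth_continuous sphi.
have : compact (phi @` closure [set x | phi x != 0]).
  by apply: continuous_compact => //; exact: continuous_subspaceT.
move=> /compact_bounded [M [_ HM]]; exists (`|M| + 1) => x.
have [->|px] := eqVneq (phi x) 0; first by rewrite normr0 addr_ge0.
apply: (HM (`|M| + 1)); last by exists x => //; exact: subset_closure.
by rewrite (le_lt_trans (ler_norm M))// ltrDl.
Qed.

Lemma test_measurable phi : test_function Omega phi -> measurable_fun [set: 'rV[R]_n] phi.
Proof. by move=> /test_smooth/smooth_continuous; exact: continuous_measurable_rV. Qed.

Lemma test_cube phi : test_function Omega phi ->
  exists M, 0 < M /\ forall x, ~ cube M x -> phi x = 0.
Proof.
move=> [_ /compact_bounded/bounded_sub_cube[M [M0 HM]] _]; exists M; split=> // x Mx.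
apply/eqP; apply: contrapT => /negP h.
by apply/Mx/HM; exact: subset_closure.
Qed.

End TestFunctions.

(** * The integral of a partial derivative *)

Section Divergence.
Context {R : realType}.

(** The chain rule along a line: it moves directional derivatives between
    [R * 'rV_n] and ['rV_n.+1]. *)
Lemma is_derive_affine (V W : normedModType R) (f : V -> R) (c : W -> V)
    (y w : W) (v : V) (df : R) :
  (forall h : R, c (h *: w + y) = h *: v + c y) ->
  is_derive (c y) v f df -> is_derive y w (f \o c) df.
Proof.
move=> cE [dv de].
have E : (fun h : R => h^-1 *: (((f \o c) \o shift y) (h *: w) - (f \o c) y)) =
    (fun h => h^-1 *: ((f \o shift (c y)) (h *: v) - f (c y))).
  by apply/funext => h /=; rewrite cE.
split; first by rewrite /derivable E.
by rewrite -de /derive E.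
Qed.

Lemma integral_derive_R (F G : R -> R) (M : R) : 0 < M ->
  (forall t : R, is_derive t 1 F (G t)) -> continuous G ->
  (forall t : R, t \notin `[-M, M] -> F t = 0 /\ G t = 0) ->
  (\int[lebesgue_measure]_t (G t)%:E = 0)%E.
Proof.
move=> M0 dF cG out.
have cF : continuous F.
  by move=> t; apply: differentiable_continuous; apply/derivable1_diffP; case: (dF t).
(* The slightly larger interval makes [F] vanish at the endpoints. *)
have ab : - (M + 1) < M + 1 by lra.
rewrite (_ : (\int[_]_t _ = \int[lebesgue_measure]_(t in `[(- (M + 1))%R, (M + 1)%R]) (G t)%:E)%E).
  rewrite (@continuous_FTC2 _ G F)//.
  - have Mp : (M + 1) \notin `[- M, M].
      by rewrite in_itv /= negb_and -!ltNge; apply/orP; right; lra.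
    have Mn : (- (M + 1)) \notin `[- M, M].
      by rewrite in_itv /= negb_and -!ltNge; apply/orP; left; lra.
    by have [-> _] := out _ Mp; have [-> _] := out _ Mn; rewrite subee.
  - exact: continuous_subspaceT.
  - split; [|exact: cvg_at_right_filter (cF _)|exact: cvg_at_left_filter (cF _)].
    by move=> t _; case: (dF t).
  - by move=> t _; rewrite derive1E; case: (dF t).
rewrite [RHS]integral_mkcond; apply: eq_integral => t _; rewrite patchE.
case: ifPn => // /negP tM; have [|_ ->//] := out t.
by apply/negP => h; apply: tM; rewrite inE /=; move: h; rewrite !in_itv /=; lra.
Qed.

Lemma bounded_cube_integrable n (g : 'rV[R]_n -> R) (M B : R) :
  measurable_fun [set: 'rV[R]_n] g -> (forall x, `|g x| <= B) ->
  (forall x, ~ cube M x -> g x = 0) ->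
  (lebesgue_rV n).-integrable [set: 'rV[R]_n] (EFin \o g).
Proof.
move=> mg gB g0.
rewrite (_ : EFin \o g = (EFin \o g) \_ (cube M)); last first.
  apply/funext => x; rewrite patchE; case: ifPn => // /negP Mx.
  by rewrite /= g0// => Cx; apply: Mx; rewrite inE.
rewrite -integrable_mkcond; last exact: measurable_cube.
apply: measurable_bounded_integrable; first exact: measurable_cube.
- exact: cube_measure_lty.
- exact: measurable_funS mg.
- exists B; split; first exact: num_real.
  by move=> b Bb x _ /=; rewrite (le_trans (gB x))// ltW.
Qed.

Lemma rV_cons_add0 n (h t : R) (y : 'rV[R]_n) :
  rV_cons (h + t, y) = h *: delta_mx ord0 ord0 + rV_cons (t, y).
Proof.
apply/rowP => j; rewrite !mxE eqxx /=; case: (unliftP ord0 j) => [k|] -> /=.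
  by rewrite mulr0 add0r.
by rewrite mulr1.
Qed.

Lemma rV_cons_addS n (h t : R) (y : 'rV[R]_n) j :
  rV_cons (t, h *: delta_mx ord0 j + y) =
  h *: delta_mx ord0 (lift ord0 j) + rV_cons (t, y).
Proof.
apply/rowP => k; rewrite !mxE eqxx /=; case: (unliftP ord0 k) => [l|] -> /=.
  by rewrite !mxE eqxx /= (inj_eq lift_inj).
by rewrite mulr0 add0r.
Qed.

(** Fubini separates the first coordinate. If the direction [i] is the first one,
    the inner integral vanishes by the fundamental theorem of calculus;
    otherwise each slice is an instance of the claim in one dimension less.
    The hypotheses constrain [f] and [g] along the direction [i] only, so that
    they pass to slices. *)
Lemma integral_partial_eq0 n (i : 'I_n) (f g : 'rV[R]_n -> R) (M B : R) :
  0 < M ->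
  (forall x, is_derive x (delta_mx ord0 i : 'rV[R]_n) f (g x)) ->
  measurable_fun [set: 'rV[R]_n] g ->
  (forall x, continuous (fun t : R => g (t *: delta_mx ord0 i + x))) ->
  (forall x, `|g x| <= B) ->
  (forall x, ~ cube M x -> f x = 0 /\ g x = 0) ->
  (\int[lebesgue_rV n]_x (g x)%:E = 0)%E.
Proof.
move=> M0; elim: n i f g => [[]//|n IH] i f g df mg cg gB out.
have ig : (lebesgue_rV n.+1).-integrable [set: 'rV[R]_n.+1] (EFin \o g).
  by apply: bounded_cube_integrable mg gB _ => x /out[].
have mgE : measurable_fun [set: 'rV[R]_n.+1] (EFin \o g) by exact/measurable_EFinP.
have mc := @measurable_rV_cons R n.
have igc : (lebesgue_measure \x lebesgue_rV n)%E.-integrable setT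
    ((EFin \o g) \o @rV_cons R n).
  apply/integrableP; split; first exact: measurableT_comp.
  move: ig => /integrableP[_]; rewrite ge0_integral_pushforward//.
  exact: measurableT_comp.
rewrite -[LHS]/(\int[pushforward (lebesgue_measure \x lebesgue_rV n) (@rV_cons R n)]_x
  (EFin \o g) x)%E integral_pushforward// preimage_setT.
case: (unliftP ord0 i) df cg => [j|] -> df cg.
  rewrite -integral12_prod_meas1//; apply: integral0_eq => t _.
  rewrite /fubini_F /=; apply: (IH j (fun y => f (rV_cons (t, y)))).
  - move=> y; apply: (is_derive_affine (c := fun y => rV_cons (t, y)) _ (df _)).
    by move=> h; exact: rV_cons_addS.
  - apply: measurableT_comp mg _; apply: measurableT_comp mc _.
    exact: measurable_fun_pair.
  - by move=> y; under eq_fun do rewrite rV_cons_addS; exact: cg.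
  - by move=> y; exact: gB.
  - move=> y My; apply: out => Cx; apply: My => k.
    by have := Cx (lift ord0 k); rewrite rV_consS.
rewrite -integral21_prod_meas1//; apply: integral0_eq => y _.
rewrite /fubini_G /=.
apply: (@integral_derive_R (fun t => f (rV_cons (t, y))) _ M) => //.
- move=> t; apply: (is_derive_affine (c := fun t => rV_cons (t, y)) _ (df _)).
  by move=> h; rewrite -rV_cons_add0 -[_ *: _]/(_ * _) mulr1.
- have := cg (rV_cons (0, y)).
  by under eq_fun do rewrite -rV_cons_add0 addr0.
- move=> t /negP Mt; apply: out => Cx; apply: Mt.
  by have := Cx ord0; rewrite rV_cons0.
Qed.

Lemma test_integral_partial n (Omega : set 'rV[R]_n) (i : 'I_n) phi :
  test_function Omega phi ->
  (\int[lebesgue_rV n]_x (partial i phi x)%:E = 0)%E.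
Proof.
move=> tphi; have tp := test_partial i tphi.
have [M [M0 HM]] := test_cube tphi; have [M' [M'0 HM']] := test_cube tp.
have [B HB] := test_bounded tp.
have MM : 0 < Num.max M M' by rewrite lt_max M0.
have cubeS (a b : R) : a <= b -> @cube R n a `<=` cube b.
  move=> ab x Cx j; have := Cx j; rewrite !in_itv /= => /andP[h1 h2].
  by rewrite (le_trans h2)// andbT (le_trans _ h1)// lerN2.
apply: (@integral_partial_eq0 n i phi _ _ B MM) => //.
- move=> x; apply: derivableP; apply: diff_derivable; apply: smooth_diff.
  exact: test_smooth tphi.
- exact: test_measurable tp.
- move=> x t; apply: (@continuous_comp _ _ _ (fun t : R => t *: _ + x) (partial i phi)).
    apply: cvgD; last exact: cvg_cst.
    by apply: cvgZr_tmp; exact: cvg_id.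
  by apply: smooth_continuous; exact: test_smooth tp.
- move=> x Mx; split; [apply: HM|apply: HM'] => h; apply: Mx; apply: cubeS h.
    by rewrite le_max lexx.
  by rewrite le_max lexx orbT.
Qed.

End Divergence.

(** * The fundamental lemma of the calculus of variations *)

Section FlatFunction.
Context {R : realType}.
Variable c : R.
Hypothesis c0 : 0 < c.
Implicit Type p : {poly R}.

(** The functions p(1/t) exp(-c/t), extended by 0 to t <= 0, form a family
    closed under differentiation; it contains exp(-c/t). *)
Definition flat p (t : R) : R :=
  if 0 < t then p.[t^-1] * expR (- c * t^-1) else 0.

Definition flat_step p := 'X^2 * (c *: p - p^`()).

(** From 1 + x <= exp x at x = d s / (k + 1), raised to the power k. *)
Lemma expr_le_expR (k : nat) (d : R) : 0 < d ->
  exists C, forall s, 0 <= s -> s ^+ k <= C * expR (d * s).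
Proof.
move=> d0; exists ((k.+1%:R / d) ^+ k) => s s0.
have k0 : 0 < k.+1%:R :> R by [].
have h : s <= k.+1%:R / d * expR (d * s / k.+1%:R).
  have := @expR_ge1Dx R (d * s / k.+1%:R).
  rewrite -(@ler_pM2l _ (k.+1%:R / d)) ?divr_gt0//; apply: le_trans.
  rewrite mulrDr mulr1 (_ : _ * (d * s / _) = s); first by rewrite lerDr divr_ge0// ltW.
  by field; rewrite gt_eqF//= gt_eqF.
apply: (@le_trans _ _ ((k.+1%:R / d * expR (d * s / k.+1%:R)) ^+ k)).
  by rewrite lerXn2r// ?nnegrE// mulr_ge0// ?expR_ge0// divr_ge0// ltW.
rewrite exprMn ler_wpM2l//; first by rewrite exprn_ge0// divr_ge0// ltW.
rewrite -expRM_natl ler_expR mulrA ler_pdivrMr// mulrC.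
by rewrite ler_wpM2l ?mulr_ge0 ?(ltW d0)// ler_nat.
Qed.

Lemma horner_le_expR p (d : R) : 0 < d ->
  exists C, forall s, 0 <= s -> `|p.[s]| <= C * expR (d * s).
Proof.
move=> d0; have /choice[C HC] := fun k => expr_le_expR k d0.
exists (\sum_(i < size p) `|p`_i| * C i) => s s0.
rewrite horner_coef (le_trans (ler_norm_sum _ _ _))// mulr_suml ler_sum// => i _.
by rewrite normrM -mulrA ler_wpM2l// (ger0_norm (exprn_ge0 _ s0)) HC.
Qed.

(** Half of the exponential decay absorbs the polynomial, the other half leaves
    a factor t. *)
Lemma flat_bound p : exists C, forall t, `|flat p t| <= C * `|t|.
Proof.
have c20 : 0 < c / 2 by rewrite divr_gt0.
have [C HC] := horner_le_expR p c20.
have C0 : 0 <= C.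
  have := HC 0 (lexx 0); rewrite mulr0 expR0 mulr1; exact: le_trans.
exists (C * (2 / c)) => t; rewrite /flat; case: ifPn => [t0|_]; last first.
  by rewrite normr0 !mulr_ge0// ?invr_ge0 ltW.
have s0 : 0 < t^-1 by rewrite invr_gt0.
rewrite normrM (ger0_norm (expR_ge0 _)) (ger0_norm (ltW t0)).
apply: (@le_trans _ _ (C * expR (c / 2 * t^-1) * expR (- c * t^-1))).
  by rewrite ler_wpM2r ?expR_ge0// HC// ltW.
rewrite -!mulrA ler_wpM2l// -expRD.
rewrite (_ : _ + _ = - (c / 2 * t^-1)); last by field; rewrite gt_eqF.
rewrite expRN -[leRHS]invrK lef_pV2 ?posrE ?expR_gt0//; last first.
  by rewrite invr_gt0 !mulr_gt0// invr_gt0.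
rewrite (_ : (2 * _)^-1 = c / 2 * t^-1); last by field; rewrite !gt_eqF.
by rewrite (le_trans _ (expR_ge1Dx _))// lerDr.
Qed.

(** At t = 0 the difference quotient of [flat p] is [flat ('X * p)], which tends
    to 0 by [flat_bound]. *)
Lemma flat_derive p (t : R) : is_derive t 1 (flat p) (flat (flat_step p) t).
Proof.
have [t0|t0|t0] := ltgtP t 0.
- rewrite {2}/flat ifF; last by apply/negbTE; rewrite -leNgt ltW.
  apply: (@near_eq_is_derive R R R (cst 0)).
  near=> y; rewrite /flat ifF//; apply/negbTE; rewrite -leNgt ltW//.
  by near: y; exact: lt_nbhsl.
- apply: (@near_eq_is_derive _ _ _
    ((fun y => p.[y^-1]) * (fun y => expR (- c * y^-1)))).
    near=> y; rewrite /flat ifT//; near: y; exact: lt_nbhsr.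
  have tn0 : t != 0 by rewrite gt_eqF.
  have dV : is_derive t 1 (fun y : R => y^-1) (- t ^- 2).
    by apply: is_derive_eq; [apply: is_deriveV|rewrite -[_ *: _]/(_ * _) mulr1].
  have dp : is_derive t 1 (fun y : R => p.[y^-1]) (p^`().[t^-1] * - t ^- 2).
    have dh : is_derive t^-1 1 (horner p) (p^`().[t^-1]).
      have := @derivable_horner R p t^-1 => dh; apply: DeriveDef => //.
      by rewrite -derive1E -derivE.
    exact: (@is_derive1_comp _ (horner p) (fun y => y^-1)).
  have de : is_derive t 1 (fun y : R => expR (- c * y^-1))
      (expR (- c * t^-1) * (- c *: - t ^- 2)).
    by apply: (@is_derive1_comp _ expR (fun y => - c * y^-1)).
  move: (is_deriveM dp de); set v := (X in is_derive _ _ _ X -> _).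
  suff -> : v = flat (flat_step p) t by [].
  rewrite {}/v.
  rewrite /flat t0 /flat_step -![_ *: _]/(_ * _).
  rewrite !(hornerM, hornerD, hornerN, hornerZ, hornerXn, hornerX).
  by field.
- rewrite t0 {2}/flat ltxx; have [C HC] := flat_bound ('X * p).
  suff H : h^-1 *: ((flat p \o shift (0 : R)) (h *: 1) - flat p 0) @[h --> (0 : R)^'] --> (0 : R).
    split; first by apply/cvg_ex; exists 0.
    exact: cvg_lim H.
  apply/cvgrPdist_le => e e0; near=> h.
  have h0 : h != 0 by near: h; exact: nbhs_dnbhs_neq.
  rewrite sub0r normrN /= addr0 -![_ *: _]/(_ * _) mulr1 [flat p 0]/flat ltxx subr0.
  rewrite (_ : h^-1 * flat p h = flat ('X * p) h); last first.
    rewrite /flat; case: ifPn => _; last by rewrite mulr0.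
    by rewrite hornerM hornerX mulrA.
  rewrite (le_trans (HC h))// (@le_trans _ _ ((`|C| + 1) * `|h|))//.
    by rewrite ler_wpM2r// (le_trans (ler_norm C))// lerDl.
  rewrite mulrC -ler_pdivlMr ?ltr_wpDl//.
  near: h; apply: dnbhs0_le; rewrite divr_gt0// ltr_wpDl//.
Unshelve. all: by end_near. Qed.

Definition flat_fun (t : R) : R := if 0 < t then expR (- c * t^-1) else 0.

Lemma smooth_flat n (f : 'rV[R]_n -> R) : smooth f -> smooth (flat_fun \o f).
Proof.
move=> sf; rewrite (_ : flat_fun = flat (iter 0 flat_step 1)).
  by apply: (smooth_compo (h := fun k => flat (iter k flat_step 1))) => // k t; exact: flat_derive.
by apply/funext => t; rewrite /flat hornerC mul1r.
Qed.

Lemma flat_ge0 t : 0 <= flat_fun t.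
Proof. by rewrite /flat_fun; case: ifPn => // _; exact: expR_ge0. Qed.

Lemma flat_le1 t : flat_fun t <= 1.
Proof.
rewrite /flat_fun; case: ifPn => // t0; rewrite -expR0 ler_expR mulNr oppr_le0.
by rewrite mulr_ge0 ?invr_ge0// ltW.
Qed.

Lemma flat_gt0 t : (flat_fun t != 0) = (0 < t).
Proof. by rewrite /flat_fun; case: ifPn => _; rewrite ?eqxx// gt_eqF// expR_gt0. Qed.

End FlatFunction.

(** As c tends to 0, exp(-c/t) increases to the indicator of t > 0. *)
Lemma flat_cvg {R : realType} (t : R) :
  flat_fun k.+1%:R^-1 t @[k --> \oo] --> ((0 < t)%R%:R : R).
Proof.
rewrite /flat_fun; have [t0|t0] := boolP (0 < t); last exact: cvg_cst.
rewrite -[X in _ --> X]expR0; apply: continuous_cvg; first exact: continuous_expR.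
rewrite -[X in _ --> X](mul0r t^-1); apply: cvgMr_tmp.
rewrite -oppr0; apply: cvgN; exact: cvg_harmonic.
Qed.

Lemma cvg_prod_seq {R : realType} (I : Type) (r : seq I) (F : I -> nat -> R) (l : I -> R) :
  (forall i, F i k @[k --> \oo] --> l i) ->
  (\prod_(i <- r) F i k) @[k --> \oo] --> \prod_(i <- r) l i.
Proof.
move=> Fl; elim: r => [|i r IH].
  by under eq_fun do rewrite big_nil; rewrite big_nil; exact: cvg_cst.
by under eq_fun do rewrite big_cons; rewrite big_cons; apply: cvgM.
Qed.

Section FundamentalLemma.
Context {R : realType} {n : nat}.
Variable Omega : set 'rV[R]_n.
Hypothesis oO : open Omega.
Notation mu := (@lebesgue_rV R n).
Notation L2 := (square_integrable mu Omega).
Notation ip := (inner mu Omega).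

Let mO : measurable Omega := open_measurable_rV oO.

Definition bump (c : 'rV[R]_n) (e : R) (x : 'rV[R]_n) : R :=
  \prod_(i < n) (flat_fun 1 (e + (x ord0 i - c ord0 i)) *
                 flat_fun 1 (e - (x ord0 i - c ord0 i))).

Lemma bump_neq0 c e x :
  (bump c e x != 0) = [forall i, `|c ord0 i - x ord0 i| < e].
Proof.
rewrite /bump; apply/prodf_neq0/forallP => [h i|h i _].
  have := h i isT; rewrite mulf_eq0 negb_or !flat_gt0 distrC ltr_norml.
  by move=> /andP[h1 h2]; apply/andP; split; lra.
have := h i; rewrite mulf_eq0 negb_or !flat_gt0 distrC ltr_norml.
by move=> /andP[h1 h2]; apply/andP; split; lra.
Qed.

Lemma smooth_bump c e : smooth (bump c e).
Proof.
have s01 : (0 : R) < 1 by [].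
apply: smooth_prod => i.
have sx : smooth (fun x : 'rV[R]_n => x ord0 i - c ord0 i).
  by apply: (smoothD (smooth_coord i)); exact: smooth_cst.
have sN : smooth (fun x : 'rV[R]_n => - (x ord0 i - c ord0 i)).
  rewrite (_ : (fun x => _) = (-1) *: (fun x : 'rV[R]_n => x ord0 i - c ord0 i)).
    exact: smoothZ.
  by apply/funext => x; rewrite -[RHS]/(_ * _) mulN1r.
have s1 := smooth_flat s01 (smoothD (smooth_cst e) sx).
have s2 := smooth_flat s01 (smoothD (smooth_cst e) sN).
exact: smoothM s1 s2.
Qed.

Lemma test_bump (c : 'rV[R]_n) (e : R) :
  (forall y : 'rV[R]_n, (forall i, `|c ord0 i - y ord0 i| <= e) -> Omega y) ->
  test_function Omega (bump c e).
Proof.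
move=> cO.
pose K := [set x : 'rV[R]_n | forall i, `[c ord0 i - e, c ord0 i + e]%classic (x ord0 i)].
have KE x : K x <-> forall i, `|c ord0 i - x ord0 i| <= e.
  by split=> h i; have := h i; rewrite /= in_itv /= distrC ler_distl.
apply: (@test_function_support _ _ _ _ K); first exact: smooth_bump.
- apply: (@rV_compact R n (fun i => `[c ord0 i - e, c ord0 i + e]%classic)) => i.
  exact: segment_compact.
- by move=> x /KE; exact: cO.
- move=> x; rewrite bump_neq0 => /forallP h; apply/KE => i.
  exact/ltW/h.
Qed.

Definition orthant_approx (a : 'rV[R]_n) (k : nat) (x : 'rV[R]_n) : R :=
  \prod_(i < n) flat_fun k.+1%:R^-1 (x ord0 i - a ord0 i).

Definition orthant (a : 'rV[R]_n) : set 'rV[R]_n := [set x | forall i, a ord0 i < x ord0 i].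

Lemma smooth_orthant_approx a k : smooth (orthant_approx a k).
Proof.
apply: smooth_prod => i.
have s01 : (0 : R) < k.+1%:R^-1 by rewrite invr_gt0.
have h := smooth_flat s01 (smoothD (smooth_coord i) (@smooth_cst R n (- a ord0 i))).
exact: h.
Qed.

Lemma orthant_approx_le1 a k x : `|orthant_approx a k x| <= 1.
Proof.
have s01 : (0 : R) < k.+1%:R^-1 by rewrite invr_gt0.
rewrite /orthant_approx normr_prod.
set P := (X in X <= _); suff /andP[] : 0 <= P <= 1 by [].
rewrite {}/P; elim/big_ind: _ => [|u v /andP[u0 u1] /andP[v0 v1]|i _].
- by rewrite ler01 lexx.
- by rewrite mulr_ge0 ?mulr_ile1.
- by rewrite normr_ge0/= ger0_norm ?flat_ge0// flat_le1.
Qed.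

Lemma orthant_approx_cvg a x :
  orthant_approx a k x @[k --> \oo] --> (\1_(orthant a) x : R).
Proof.
rewrite (_ : \1_(orthant a) x = \prod_(i < n) (0 < x ord0 i - a ord0 i)%R%:R); last first.
  rewrite indicE; have [/set_mem ax|/negP ax] := boolP (x \in orthant a).
    by rewrite big1// => i _; rewrite subr_gt0 ax.
  have [i ai] : exists i, ~~ (0 < x ord0 i - a ord0 i).
    apply/existsP; rewrite -negb_forall; apply/negP => /forallP h.
    by apply: ax; rewrite inE => i; rewrite -subr_gt0.
  by rewrite (bigD1 i)//= (negbTE ai) mul0r.
by apply: cvg_prod_seq => i; exact: flat_cvg.
Qed.

Lemma orthant_setI : setI_closed (range orthant).
Proof.
move=> _ _ [a _ <-] [b _ <-].
exists (\row_i Num.max (a ord0 i) (b ord0 i)) => //.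
apply/seteqP; split=> x /= h.
  by split=> i; have := h i; rewrite mxE gt_max => /andP[].
by move=> i; case: h => ha hb; rewrite mxE gt_max ha hb.
Qed.

Lemma measurable_orthant a : measurable (orthant a).
Proof.
rewrite (_ : orthant a =
    \bigcap_(i in [set: 'I_n]) (rV_coord i @^-1` `]a ord0 i, +oo[%classic)).
  apply: fin_bigcap_measurable => // i _; rewrite -[X in measurable X]setTI.
  by apply: measurable_rV_coord => //; exact: measurable_itv.
by apply/seteqP; split=> x h i; [move=> _ /=|]; have := h i; rewrite /= in_itv /= andbT//; apply.
Qed.

(** The Borel sigma-algebra is generated by the coordinates, and a half-space
    in one coordinate is a countable union of orthants whose other thresholds
    tend to minus infinity. *)
Lemma measurable_rV_orthants : @measurable _ 'rV[R]_n = <<s range orthant >>.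
Proof.
apply/seteqP; split; last first.
  apply: smallest_sub; first exact: sigma_algebra_measurable.
  by move=> _ [a _ <-]; exact: measurable_orthant.
apply: smallest_sub; first exact: smallest_sigma_algebra.
elim/big_ind: _ => [//|A B hA hB|i _]; first by rewrite subUset.
have mi : @measurable_fun _ _ (g_sigma_algebraType (range orthant)) R setT (rV_coord i).
  apply: (measurability _ (RGenOInfty.measurableE R)).
  move=> _ [_ [a ->] <-]; rewrite setTI.
  rewrite (_ : _ @^-1` _ = \bigcup_k
     orthant (\row_j (if j == i then a else - k%:R))); last first.
    apply/seteqP; split=> [x|x [k _]] /=.
      rewrite in_itv /= andbT => ax.
      exists (Num.truncn `|x|).+1 => // j; rewrite mxE; case: eqP => [->//|_].
      rewrite ltrNl (le_lt_trans (ler_norm _))// normrN.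
      by rewrite (le_lt_trans (coord_le_norm x j))// truncnS_gt.
    by move=> /(_ i); rewrite mxE eqxx in_itv /= andbT.
  apply: bigcup_measurable => k _; apply: sub_sigma_algebra.
  by eexists.
by move=> _ [B mB <-]; exact: mi.
Qed.

(** The indicator of an orthant is a bounded limit of smooth functions, so the
    product integrates to zero over every orthant. Orthants are a pi-system
    generating the Borel sets, hence by Dynkin's theorem the product integrates
    to zero over every Borel set. *)
Lemma fundamental_bump (H phi : 'rV[R]_n -> R) : L2 H ->
  test_function Omega phi -> L2 phi ->
  (forall psi, test_function Omega psi -> ip H psi = 0) ->
  {ae mu, forall x, Omega x -> H x * phi x = 0}.
Proof.
move=> lH tphi lphi HP.
have iF := L2_mul mO lH lphi; set F := fun x => H x * phi x in iF *.
have mF : measurable_fun Omega F by exact: intbl_measurable iF.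
have iFE E : measurable E -> mu.-integrable (Omega `&` E) (EFin \o F).
  by move=> mE; apply: integrableS iF => //; exact: measurableI.
have FT : (\int[mu]_(x in Omega) (F x)%:E = 0)%E.
  have := HP _ tphi; rewrite /inner /Rintegral -/F => h.
  by rewrite -[LHS]fineK ?h//; exact: integrable_fin_num.
have F0 E : measurable E -> (\int[mu]_(x in Omega `&` E) (F x)%:E = 0)%E.
  move=> mE; have sE : <<s range orthant >> E by rewrite -measurable_rV_orthants.
  pose P := [set E | (\int[mu]_(x in Omega `&` E) (F x)%:E = 0)%E].
  apply: (@dynkin_induction _ 'rV[R]_n (range orthant) P) sE.
  - exact: measurable_rV_orthants.
  - exact: orthant_setI.
  - by rewrite /P /= setIT.
  - move=> _ [a _ <-]; rewrite /P /= integral_mkcondr.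
    have [] := @dominated_convergence _ _ _ mu Omega mO
      (fun k x => (H x * (orthant_approx a k x * phi x))%:E)
      ((EFin \o F) \_ (orthant a)) (fun x => `|F x|%:E).
    + move=> k; apply/measurable_EFinP; apply: measurable_funM; first by case: lH.
      apply: measurable_funM; last by case: lphi.
      apply: measurable_funS (continuous_measurable_rV _) => //.
      exact/smooth_continuous/smooth_orthant_approx.
    + apply/(measurable_restrict _ (measurable_orthant a)) => //.
      apply/measurable_EFinP; apply: measurable_funS mF => //.
    + apply: aeW => x _; rewrite [X in _ --> X](_ : _ = (F x * \1_(orthant a) x)%:E); last first.
        by rewrite patchE indicE; case: ifPn => _; rewrite ?mulr1 ?mulr0.
      apply: cvg_EFin; first exact: nearW.
      rewrite [X in X @ _](_ : _ = fun k => F x * orthant_approx a k x); last first.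
        by apply/funext => k /=; rewrite /F; ring.
      by apply: cvgMl_tmp; exact: orthant_approx_cvg.
    + exact: integrable_norm.
    + apply: aeW => x k _; rewrite lee_fin /F mulrCA normrM.
      by rewrite ler_piMl// orthant_approx_le1.
    move=> _ _; set u := (X in X @ _ --> _); have -> : u = cst 0%E.
      apply/funext => k; rewrite /u.
      have tk := test_Ml tphi (smooth_orthant_approx a k).
      have lk : L2 (orthant_approx a k * phi).
        apply: (L2_mulb mO _ lphi (fun x _ => orthant_approx_le1 a k x)).
        apply: measurable_funS (continuous_measurable_rV _) => //.
        exact/smooth_continuous/smooth_orthant_approx.
      have := HP _ tk; rewrite /inner /Rintegral => h.
      rewrite -[LHS]fineK ?h//.
      by have := integrable_fin_num mO (L2_mul mO lH lk).
    by move=> h; rewrite -(cvg_lim _ h)// lim_cst.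
  - move=> E' mE' E0; rewrite /P /= -setDE.
    have FT' := FT; rewrite -(setUIDK Omega E') integral_setU_EFin// in FT'.
    + by move: FT'; rewrite [X in (X + _)%E]E0 add0e.
    + exact: measurableI.
    + exact: measurableD.
    + by rewrite setUIDK.
    + by apply/disj_setPS => x [[_ h] [_]].
  - move=> E' mE' tE' E0; rewrite /P /= setI_bigcupr integral_bigcup.
    + by apply: eseries0 => k _ _; exact: E0.
    + exact: trivIset_setIl.
    + by move=> k; exact: measurableI.
    + by rewrite -setI_bigcupr; apply: iFE; exact: bigcup_measurable.
have := @integral_ae_eq _ _ _ mu Omega mO (cst 0%E) (EFin \o F) iF.
move=> /(_ (measurable_cst _)).
have h E : E `<=` Omega -> measurable E ->
    (\int[mu]_(x in E) (EFin \o F) x = \int[mu]_(x in E) cst 0 x)%E.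
  move=> EO mE; rewrite integral0 -(F0 E mE); congr integral.
  by rewrite setIC; apply/esym/setIidPl.
by move=> /(_ h); apply: filterS => x /[apply] /= [[]].
Qed.

(** The domain is covered by countably many rational cubes, each carrying a bump
    function that does not vanish inside it. *)
Lemma fundamental_lemma (H : 'rV[R]_n -> R) : L2 H ->
  (forall psi, test_function Omega psi -> L2 psi) ->
  (forall psi, test_function Omega psi -> ip H psi = 0) ->
  {ae mu, forall x, Omega x -> H x = 0}.
Proof.
move=> lH L2t HP.
(* Centre and half-side of the [m]-th rational cube; the default value is
   harmless, since only cubes contained in the domain are used. *)
pose C (m : nat) : 'rV[R]_n * R := 
  if unpickle m is Some (q, k) then (map_mx ratr (q : 'rV[rat]_n), (k : nat).+1%:R^-1) else (0, 0).
pose good m := forall y : 'rV[R]_n,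
  (forall i, `|(C m).1 ord0 i - y ord0 i| <= (C m).2) -> Omega y.
have H0 m : {ae mu, forall x, Omega x -> good m -> H x * bump (C m).1 (C m).2 x = 0}.
  have [gm|gm] := pselect (good m); last by apply: aeW.
  have t := test_bump gm.
  by apply: filterS (fundamental_bump lH t (L2t _ t) HP) => x h /h.
have := ae_foralln H0; apply: filterS => x h Ox.
have [q [k [qx qO]]] := rational_cube oO Ox.
have := h (pickle (q, k)) Ox; rewrite /good /C pickleK /=.
have g : forall y : 'rV_n, (forall i, `|map_mx ratr q ord0 i - y ord0 i| <= k.+1%:R^-1) -> Omega y.
  by move=> y hy; apply: qO => i; have := hy i; rewrite mxE.
move=> /(_ g) /eqP; rewrite mulf_eq0 => /orP[/eqP//|].
have : bump (map_mx ratr q) k.+1%:R^-1 x != 0.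
  by rewrite bump_neq0; apply/forallP => i; rewrite mxE.
by move=> /negbTE ->.
Qed.

End FundamentalLemma.

(** * Strong gradients *)

Section StrongGradient.
Context {R : realType} {n : nat}.
Variable Omega : set 'rV[R]_n.
Hypotheses (oO : open Omega) (bO : bounded_set Omega).
Notation mu := (@lebesgue_rV R n).
Notation L2 := (square_integrable mu Omega).
Notation ip := (inner mu Omega).
Implicit Types (u v phi psi : 'rV[R]_n -> R) (G H : 'rV[R]_n -> 'rV[R]_n).

Let mO : measurable Omega := open_measurable_rV oO.

Lemma Omega_lty : (mu Omega < +oo)%E.
Proof.
have [M [_ OM]] := bounded_sub_cube bO.
apply: le_lt_trans (cube_measure_lty M).
by apply: le_measure => //; rewrite inE//; exact: measurable_cube.
Qed.

Lemma bounded_L2 u (M : R) : measurable_fun Omega u ->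
  (forall x, Omega x -> `|u x| <= M) -> L2 u.
Proof.
move=> mu uM; split=> //; apply: measurable_bounded_integrable => //.
- exact: Omega_lty.
- exact: measurable_funX.
- exists (M ^+ 2); split; first exact: num_real.
  move=> b Mb x Ox /=; rewrite (le_trans _ (ltW Mb))// normrX.
  by rewrite lerXn2r ?nnegrE ?uM// (le_trans _ (uM x Ox)).
Qed.

Lemma test_L2 phi : test_function Omega phi -> L2 phi.
Proof.
move=> t; have [M HM] := test_bounded t.
by apply: (@bounded_L2 _ M) => //; exact: measurable_funS (test_measurable t).
Qed.

Definition component G i : 'rV[R]_n -> R := fun x => G x ord0 i.

Definition gradient phi : 'rV[R]_n -> 'rV[R]_n := fun x => \row_i partial i phi x.

Lemma component_gradient phi i : component (gradient phi) i = partial i phi.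
Proof. by apply/funext => x; rewrite /component mxE. Qed.

Lemma componentD G H i : component (G + H) i = component G i + component H i.
Proof. by apply/funext => x; rewrite /component mxE. Qed.

Lemma componentZ c G i : component (c *: G) i = c *: component G i.
Proof. by apply/funext => x; rewrite /component mxE. Qed.

(** [G] is the gradient of [u] in the closure of the test functions. Asking for
    one test function within each [e], and not for a sequence, makes the
    relation visibly closed. *)
Definition strong_grad u G :=
  [/\ L2 u, forall i, L2 (component G i) & forall e : R, 0 < e ->
    exists phi, [/\ test_function Omega phi, ip (phi - u) (phi - u) < e &
      forall i, ip (partial i phi - component G i) (partial i phi - component G i) < e]].

Lemma strong_grad_test phi : test_function Omega phi -> strong_grad phi (gradient phi).
Proof.
move=> t; split=> [|i|e e0]; first exact: test_L2.
  by rewrite component_gradient; apply/test_L2/test_partial.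
have z f : L2 f -> ip (f - f) (f - f) = 0.
  by move=> lf; apply: ip_sq_ae0 => //; [exact: L2B|apply: aeW => x _; exact: subrr].
exists phi; split=> // [|i]; rewrite ?component_gradient z//; first exact: test_L2.
exact/test_L2/test_partial.
Qed.

Lemma strong_grad_closed u G : L2 u -> (forall i, L2 (component G i)) ->
  (forall e : R, 0 < e -> exists v H, [/\ strong_grad v H, ip (v - u) (v - u) < e &
    forall i, ip (component H i - component G i) (component H i - component G i) < e]) ->
  strong_grad u G.
Proof.
move=> lu lG h; split=> // e e0.
have e4 : 0 < e / 4 by rewrite divr_gt0.
have [v [H [[lv lH vH] vu HG]]] := h _ e4.
have [phi [t pv pH]] := vH _ e4; exists phi; split=> // [|i].
  by have := ip_sq_triangle mO (test_L2 t) lv lu; lra.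
have := ip_sq_triangle mO (test_L2 (test_partial i t)) (lH i) (lG i).
by have := HG i; have := pH i; lra.
Qed.

Lemma strong_gradD u G v H : strong_grad u G -> strong_grad v H ->
  strong_grad (u + v) (G + H).
Proof.
move=> [lu lG uG] [lv lH vH]; split=> [|i|e e0].
- exact: L2D.
- by rewrite componentD; exact: L2D.
have e4 : 0 < e / 4 by rewrite divr_gt0.
have [phi [t pu pG]] := uG _ e4; have [psi [t' qv qH]] := vH _ e4.
exists (phi + psi); split=> [||i]; first exact: test_D.
- rewrite opprD addrACA.
  by have := ip_sqD mO (L2B mO (test_L2 t) lu) (L2B mO (test_L2 t') lv); lra.
- have -> : partial i (phi + psi) = partial i phi + partial i psi.
    by apply/funext => x; rewrite partialD//; apply: smooth_diff; [case: t|case: t'].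
  rewrite componentD opprD addrACA.
  have := ip_sqD mO (L2B mO (test_L2 (test_partial i t)) (lG i))
     (L2B mO (test_L2 (test_partial i t')) (lH i)).
  by have := pG i; have := qH i; lra.
Qed.

Lemma partialZ i (c : R) phi : smooth phi -> partial i (c *: phi) = c *: partial i phi.
Proof.
move=> s; apply/funext => x; rewrite /partial deriveZ//.
exact/diff_derivable/smooth_diff.
Qed.

Lemma strong_gradZ c u G : strong_grad u G -> strong_grad (c *: u) (c *: G).
Proof.
move=> [lu lG uG]; split=> [|i|e e0].
- exact: L2Z.
- by rewrite componentZ; exact: L2Z.
have c1 : 0 < c ^+ 2 + 1 by rewrite ltr_wpDl// sqr_ge0.
have e4 : 0 < e / (c ^+ 2 + 1) by rewrite divr_gt0.
have [phi [t pu pG]] := uG _ e4.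
have key a : a < e / (c ^+ 2 + 1) -> 0 <= a -> c ^+ 2 * a < e.
  rewrite ltr_pdivlMr// mulrDr mulr1 mulrC => h a0.
  have [->|a1] := eqVneq a 0; first by rewrite mulr0.
  by have : 0 < a; [rewrite lt_def a1|lra].
exists (c *: phi); split=> [||i]; first exact: test_Z.
- rewrite -scalerBr ip_sqZ//; first by apply: key => //; exact: ip_ge0.
  exact: L2B (test_L2 t) lu.
- rewrite partialZ; last by case: t.
  rewrite componentZ -scalerBr ip_sqZ//; first by apply: key => //; exact: ip_ge0.
  exact: L2B (test_L2 (test_partial i t)) (lG i).
Qed.

Lemma test_ibp i phi psi : test_function Omega phi -> test_function Omega psi ->
  ip phi (partial i psi) + ip (partial i phi) psi = 0.
Proof.
move=> t t'; have tt := test_Ml t' (test_smooth t).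
have [l l'] := (test_L2 t, test_L2 t').
have [lp lp'] := (test_L2 (test_partial i t), test_L2 (test_partial i t')).
rewrite /inner -RintegralD//; [|exact: L2_mul..].
rewrite /Rintegral -[RHS](_ : fine 0%E = 0)// -(test_integral_partial i tt).
rewrite integral_mkcond; congr fine; apply: eq_integral => x _.
have [s s'] := (test_smooth t, test_smooth t').
rewrite patchE partialM; [|exact: smooth_diff..].
case: ifPn => [_|/negP Ox]; first by rewrite /= [psi x * _]mulrC.
have Ox' : ~ Omega x by move=> h; apply: Ox; rewrite inE.
by rewrite (test_out t Ox') (test_out t' Ox') !mul0r addr0.
Qed.

(** By Cauchy-Schwarz both sides are continuous for the convergence of test
    functions that defines strong gradients, and for test functions the
    identity is [test_ibp]. *)
Lemma strong_grad_ibp u G i psi : strong_grad u G -> test_function Omega psi ->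
  ip u (partial i psi) = - ip (component G i) psi.
Proof.
move=> [lu lG uG] t'; have [l' lp'] := (test_L2 t', test_L2 (test_partial i t')).
apply/eqP; rewrite -subr_eq0 opprK; apply/eqP.
set a := ip u _ + _.
set C := ip (partial i psi) (partial i psi) + ip psi psi.
have C0 : 0 <= C by rewrite addr_ge0// ip_ge0.
have key (e : R) : 0 < e -> a ^+ 2 <= 2 * e * C.
  move=> e0; have [phi [t pu pG]] := uG _ e0.
  have [l lp] := (test_L2 t, test_L2 (test_partial i t)).
  have aE : a = - (ip (phi - u) (partial i psi) + ip (partial i phi - component G i) psi).
    rewrite !ipBl//; have := test_ibp i t t'; rewrite /a; lra.
  have h1 := ip_cs mO (L2B mO l lu) lp'; have h2 := ip_cs mO (L2B mO lp (lG i)) l'.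
  have := ler_wpM2r (ip_ge0 mu Omega (partial i psi)) (ltW pu).
  have := ler_wpM2r (ip_ge0 mu Omega psi) (ltW (pG i)).
  rewrite aE sqrrN sqrrD /C.
  have := sqr_ge0 (ip (phi - u) (partial i psi) - ip (partial i phi - component G i) psi).
  by rewrite sqrrB !mulr2n; lra.
apply/eqP; rewrite -sqrf_eq0 eq_le sqr_ge0 andbT leNgt; apply/negP => a0.
have C1 : 0 < 4 * (C + 1) by rewrite mulr_gt0// ltr_wpDl.
have := key _ (divr_gt0 a0 C1).
rewrite (_ : _ * C = a ^+ 2 * (C / (2 * (C + 1)))); last by field; rewrite gt_eqF// ltr_wpDl.
have : C / (2 * (C + 1)) < 1 by rewrite ltr_pdivrMr ?mulr_gt0 ?ltr_wpDl//; lra.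
rewrite -(ltr_pM2l a0); lra.
Qed.

Lemma LpP u : Lp Omega 2%:E u <-> L2 u.
Proof.
split=> [[mfu nfu]|lu]; first exact: (finite_norm_L2 mu mO mfu).1.
by have [mfu _] := lu; split=> //; exact: (finite_norm_L2 mu mO mfu).2.
Qed.

Lemma ip_integral u v : L2 u -> L2 v ->
  (\int[mu]_(x in Omega) (u x * v x)%:E = (ip u v)%:E)%E.
Proof. by move=> lu lv; rewrite fineK//; exact: integrable_fin_num (L2_mul mO lu lv). Qed.

Lemma strong_grad_weak u G : strong_grad u G -> weak_gradient Omega u G.
Proof.
move=> sG i; have [lu lG _] := sG; split; first exact/LpP/lG.
move=> psi t'; have [l' lp'] := (test_L2 t', test_L2 (test_partial i t')).
by rewrite ip_integral// (ip_integral (lG i) l') (strong_grad_ibp i sG t').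
Qed.

Lemma weak_gradient_ae u G H i : L2 u -> weak_gradient Omega u G ->
  weak_gradient Omega u H ->
  {ae mu, forall x, Omega x -> component G i x = component H i x}.
Proof.
move=> lu /(_ i)[/LpP lG hG] /(_ i)[/LpP lH hH].
have := @fundamental_lemma R n Omega oO (component G i - component H i) (L2B mO lG lH) test_L2.
have h psi : test_function Omega psi -> ip (component G i - component H i) psi = 0.
  move=> t'; have l' := test_L2 t'.
  rewrite ipBl//; apply/eqP; rewrite subr_eq0; apply/eqP.
  have := hG _ t'; rewrite hH// !ip_integral// => /oppe_inj [].
  by move=> ->.
by move=> /(_ h); apply: filterS => x /[apply] /eqP; rewrite subr_eq0 => /eqP.
Qed.

Lemma near_all_ord m (P : 'I_m -> nat -> Prop) :
  (forall i, \forall k \near \oo, P i k) -> \forall k \near \oo, forall i, P i k.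
Proof.
move=> h; have /choice[K HK] : forall i, exists K, forall k, (K <= k)%N -> P i k.
  by move=> i; have [K _ HK] := h i; exists K => k; exact: HK.
exists (\max_(i < m) K i)%N => // k /= Kk i; apply: HK.
by apply: leq_trans Kk; exact: leq_bigmax.
Qed.

Lemma dist_L2E u v : L2 u -> L2 v -> dist_L2 Omega u v = (Num.sqrt (ip (u - v) (u - v)))%:E.
Proof. by move=> lu lv; rewrite /dist_L2 (Lnorm2_eq mO (L2B mO lu lv)). Qed.

Lemma sqrt_cvg0 (a : nat -> R) : (forall k, 0 <= a k) ->
  (Num.sqrt (a k))%:E @[k --> \oo] --> 0%E <->
  (forall e : R, 0 < e -> \forall k \near \oo, a k < e).
Proof.
move=> a0; split=> [/fine_cvgP[_] /cvgrPdist_lt h e e0|h].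
  have := h (Num.sqrt e); rewrite sqrtr_gt0 => /(_ e0).
  apply: filterS => k /=; rewrite sub0r normrN ger0_norm ?sqrtr_ge0//.
  by rewrite ltr_sqrt.
apply: cvg_EFin; first exact: nearW.
apply/cvgrPdist_lt => e e0; have := h (e ^+ 2); rewrite exprn_gt0// => /(_ isT).
apply: filterS => k ak; rewrite sub0r normrN ger0_norm ?sqrtr_ge0//.
rewrite -(ger0_norm (ltW e0)) -sqrtr_sqr ltr_sqrt//.
by rewrite exprn_gt0.
Qed.

(** [wgrad] is a choice among the weak gradients. *)
Lemma wgrad_weak u G : weak_gradient Omega u G -> weak_gradient Omega u (wgrad Omega u).
Proof. by move=> uG; exact: (xgetPex (fun=> 0) (ex_intro _ _ uG)). Qed.

Lemma strong_grad_ae u u' G G' : L2 u' -> (forall i, L2 (component G' i)) ->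
  {ae mu, forall x, Omega x -> u x = u' x} ->
  (forall i, {ae mu, forall x, Omega x -> component G i x = component G' i x}) ->
  strong_grad u G -> strong_grad u' G'.
Proof.
move=> lu' lG' uu' GG' sG; apply: strong_grad_closed => // e e0.
have [lu lG _] := sG; exists u, G; split=> // [|i].
  rewrite ip_sq_ae0//; first exact: L2B.
  by apply: filterS uu' => x /[apply] h; rewrite !fctE h subrr.
rewrite ip_sq_ae0//; first exact: L2B.
by apply: filterS (GG' i) => x /[apply] h; rewrite !fctE h subrr.
Qed.

Lemma H10_strong_grad u : H10 Omega u -> strong_grad u (wgrad Omega u).
Proof.
move=> [[/LpP lu [G0 uG0]] [phi [tphi cu cG]]].
have wG := wgrad_weak uG0.
have lG i : L2 (component (wgrad Omega u) i) by have [/LpP] := wG i.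
split=> // e e0.
have nu : \forall k \near \oo, ip (phi k - u) (phi k - u) < e.
  apply: (sqrt_cvg0 (a := fun k => ip (phi k - u) (phi k - u)) _).1 => //.
    by move=> k; exact: ip_ge0.
  by under eq_fun do rewrite -(dist_L2E (test_L2 (tphi _)) lu).
have nG : \forall k \near \oo, forall i,
    ip (partial i (phi k) - component (wgrad Omega u) i)
       (partial i (phi k) - component (wgrad Omega u) i) < e.
  apply: near_all_ord => i.
  apply: (sqrt_cvg0 (a := fun k => ip (partial i (phi k) - component (wgrad Omega u) i)
       (partial i (phi k) - component (wgrad Omega u) i)) _).1 => //.
    by move=> k; exact: ip_ge0.
  by under eq_fun do rewrite -(dist_L2E (test_L2 (test_partial i (tphi _))) (lG i)); exact: cG.
have [k [h1 h2]] := filter_ex (filterI nu nG).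
by exists (phi k).
Qed.

Lemma strong_grad_wgrad u G i : strong_grad u G ->
  {ae mu, forall x, Omega x -> component (wgrad Omega u) i x = component G i x}.
Proof.
move=> sG; have wG := strong_grad_weak sG; have [lu _ _] := sG.
exact: weak_gradient_ae (wgrad_weak wG) wG.
Qed.

Lemma strong_grad_H10 u G : strong_grad u G -> H10 Omega u.
Proof.
move=> sG; have wG := strong_grad_weak sG; have [lu lG _] := sG.
have lw i : L2 (component (wgrad Omega u) i) by have [/LpP] := wgrad_weak wG i.
have sW : strong_grad u (wgrad Omega u).
  apply: (strong_grad_ae lu lw _ _ sG); first exact: aeW.
  by move=> i; apply: filterS (strong_grad_wgrad i sG) => x /[apply].
split; first by split; [exact/LpP|exists G].
have [_ _ h] := sW.
have /choice[phi Hphi] : forall k : nat, exists phi, [/\ test_function Omega phi,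
    ip (phi - u) (phi - u) < k.+1%:R^-1 & forall i,
    ip (partial i phi - component (wgrad Omega u) i)
       (partial i phi - component (wgrad Omega u) i) < k.+1%:R^-1].
  by move=> k; apply: h; rewrite invr_gt0.
have inv (e : R) : 0 < e -> \forall k \near \oo, k.+1%:R^-1 < e.
  move=> e0; have := @cvg_harmonic R => /cvgrPdist_lt /(_ e e0).
  by apply: filterS => k /=; rewrite sub0r normrN ger0_norm// invr_ge0.
exists phi; split=> [k||i]; first by have [] := Hphi k.
- have tphi k : test_function Omega (phi k) by have [] := Hphi k.
  under eq_fun do rewrite (dist_L2E (test_L2 (tphi _)) lu).
  apply/sqrt_cvg0 => [k|e /inv]; first exact: ip_ge0.
  by apply: filterS => k; apply: lt_trans; have [] := Hphi k.
- have tphi k : test_function Omega (phi k) by have [] := Hphi k.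
  under eq_fun do rewrite (dist_L2E (test_L2 (test_partial i (tphi _))) (lw i)).
  apply/sqrt_cvg0 => [k|e /inv]; first exact: ip_ge0.
  by apply: filterS => k; apply: lt_trans; have [] := Hphi k.
Qed.

Lemma H10P u : H10 Omega u <-> exists G, strong_grad u G.
Proof.
split=> [h|[G]]; last exact: strong_grad_H10.
by exists (wgrad Omega u); exact: H10_strong_grad.
Qed.

(** Integrating the partial derivative of x_i phi^2 gives
    |phi|^2 = - 2 <x_i phi, d_i phi>, and x_i is bounded by M on the domain. *)
Lemma test_poincare : exists2 C : R, 0 < C & forall i phi, test_function Omega phi ->
  ip phi phi <= C * ip (partial i phi) (partial i phi).
Proof.
have [M [M0 OM]] := bounded_sub_cube bO.
exists (4 * M ^+ 2) => [|i phi t]; first by rewrite mulr_gt0// exprn_gt0.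
pose x_ := fun x : 'rV[R]_n => x ord0 i.
have sx : smooth x_ by exact: smooth_coord.
have tx := test_Ml t sx; have s := test_smooth t.
have [l lp lx] := And3 (test_L2 t) (test_L2 (test_partial i t)) (test_L2 tx).
have xM x : Omega x -> `|x_ x| <= M.
  by move=> /OM /(_ i); rewrite in_itv /= -ler_norml.
have key : ip phi phi = - 2 * ip (x_ * phi) (partial i phi).
  have := test_ibp i tx t; rewrite (ipC _ _ (partial i _) phi).
  have -> : partial i (x_ * phi) = phi + x_ * partial i phi.
    apply/funext => x; rewrite partialM; [|exact: smooth_diff..].
    by rewrite partial_coord eqxx mulr1 addrC.
  rewrite ipDr//; last by apply/test_L2/test_Ml => //; exact: test_partial.
  rewrite [X in _ + (_ + X)](_ : _ = ip (x_ * phi) (partial i phi)); first by lra.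
  by apply: eq_Rintegral => x _; rewrite !fctE; ring.
have h1 := ip_cs mO lx lp.
have h2 : ip (x_ * phi) (x_ * phi) <= M ^+ 2 * ip phi phi.
  rewrite -ip_sqZ//; apply: ip_le => //; first exact: L2Z.
  move=> x Ox; rewrite !normrM (ger0_norm (ltW M0)); apply: ler_wpM2r => //.
  exact: xM.
have [->|p0] := eqVneq (ip phi phi) 0.
  by rewrite mulr_ge0 ?ip_ge0// mulr_ge0// sqr_ge0.
have pp : 0 < ip phi phi by rewrite lt_def p0 ip_ge0.
rewrite -(ler_pM2l pp).
have h3 := ler_wpM2r (ip_ge0 mu Omega (partial i phi)) h2.
have : ip phi phi ^+ 2 = 4 * ip (x_ * phi) (partial i phi) ^+ 2.
  by rewrite {1}key exprMn sqrrN; congr (_ * _); rewrite -natrX.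
by rewrite expr2 => ->; lra.
Qed.

Lemma poincare : exists2 C : R, 0 < C & forall i u G, strong_grad u G ->
  ip u u <= C * ip (component G i) (component G i).
Proof.
have [C C0 HC] := test_poincare.
exists (4 * C) => [|i u G [lu lG uG]]; first by rewrite mulr_gt0.
apply/ler_addgt0Pr => e e0.
have C1 : 0 < 2 + 4 * C by rewrite addr_gt0// mulr_gt0.
have [phi [t pu pG]] := uG (e / (2 + 4 * C)) (divr_gt0 e0 C1).
have [l lp] := (test_L2 t, test_L2 (test_partial i t)).
have h1 := ip_sqD mO (L2B mO lu l) l; rewrite subrK in h1.
have h2 := ip_sqD mO (L2B mO lp (lG i)) (lG i); rewrite subrK in h2.
rewrite (ip_sq_subC mO lu l) in h1.
have h3 := HC i _ t; have h4 := ler_wpM2l (ltW C0) h2.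
have h5 := ler_wpM2l (ltW C0) (ltW (pG i)).
have : e = 2 * (e / (2 + 4 * C)) + 4 * (C * (e / (2 + 4 * C))).
  by field; rewrite gt_eqF.
by move=> eE; rewrite {1}eE; lra.
Qed.

End StrongGradient.

(** * Absolute value and positive part *)

Section SmoothAbs.
Context {R : realType}.
Implicit Types r t : R.

(** A smooth approximation of the absolute value that vanishes at 0, so that it
    maps test functions to test functions. *)
Definition sabs r t : R := Num.sqrt (t ^+ 2 + r ^+ 2) - r.
Definition dsabs r t : R := t / Num.sqrt (t ^+ 2 + r ^+ 2).

Lemma sabs_pos r t : 0 < r -> 0 < t ^+ 2 + r ^+ 2.
Proof. by move=> r0; rewrite ltr_wpDl ?sqr_ge0// exprn_gt0. Qed.

Lemma sabs_root r t : 0 < r -> let A := Num.sqrt (t ^+ 2 + r ^+ 2) in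
  [/\ 0 < A, A ^+ 2 = t ^+ 2 + r ^+ 2, r <= A & `|t| <= A].
Proof.
move=> r0 A; have tr := sabs_pos t r0.
have A0 : 0 < A by rewrite sqrtr_gt0.
have A2 : A ^+ 2 = t ^+ 2 + r ^+ 2 by rewrite sqr_sqrtr// ltW.
split=> //.
  by rewrite -(@ler_pXn2r _ 2) ?nnegrE ?(ltW r0) ?(ltW A0)// A2 lerDr sqr_ge0.
rewrite -(@ler_pXn2r _ 2) ?nnegrE ?(ltW A0)// A2 real_normK ?num_real//.
by rewrite lerDl sqr_ge0.
Qed.

Lemma sabs_lipschitz r t t' : 0 < r -> `|sabs r t - sabs r t'| <= `|t - t'|.
Proof.
move=> r0; rewrite /sabs; have [A0 A2 rA tA] := sabs_root t r0.
have [B0 B2 rB tB] := sabs_root t' r0.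
set A := Num.sqrt _ in A0 A2 rA tA *; set B := Num.sqrt (t' ^+ 2 + _) in B0 B2 rB tB *.
have AB : 0 < A + B by exact: addr_gt0.
rewrite (_ : _ - _ = (t - t') * ((t + t') / (A + B))); last first.
  apply: (mulIf (x := A + B)); first by rewrite gt_eqF.
  rewrite -mulrA divfK ?gt_eqF//.
  have -> : (A - r - (B - r)) * (A + B) = A ^+ 2 - B ^+ 2 by ring.
  by rewrite A2 B2; ring.
rewrite normrM ler_piMr// normrM normfV (gtr0_norm AB) ler_pdivrMr// mul1r.
by rewrite (le_trans (ler_normD _ _))// lerD.
Qed.

Lemma sabs0 r : 0 < r -> sabs r 0 = 0.
Proof. by move=> r0; rewrite /sabs expr0n add0r sqrtr_sqr gtr0_norm// subrr. Qed.

Lemma sabs_le r t : 0 < r -> `|sabs r t| <= `|t|.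
Proof. by move=> r0; have := sabs_lipschitz t 0 r0; rewrite sabs0// !subr0. Qed.

Lemma dsabs_le1 r t : 0 < r -> `|dsabs r t| <= 1.
Proof.
move=> r0; have [A0 A2 rA tA] := sabs_root t r0.
by rewrite /dsabs normrM normfV (gtr0_norm A0) ler_pdivrMr// mul1r.
Qed.

Lemma dsabs_lipschitz r t t' : 0 < r -> `|dsabs r t - dsabs r t'| <= 2 / r * `|t - t'|.
Proof.
move=> r0; have sl := sabs_lipschitz t t' r0; move: sl.
rewrite /sabs /dsabs; have [A0 A2 rA tA] := sabs_root t r0.
have [B0 B2 rB tB] := sabs_root t' r0.
set A := Num.sqrt _ in A0 A2 rA tA *; set B := Num.sqrt (t' ^+ 2 + _) in B0 B2 rB tB *.
rewrite (_ : A - r - _ = A - B); last by ring.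
move=> AB.
rewrite (_ : _ - _ = (t - t') / A + (t' / B) * ((B - A) / A)); last first.
  by field; rewrite !gt_eqF.
have Ar : A^-1 <= r^-1 by rewrite lef_pV2 ?posrE.
have A0' : 0 <= A^-1 by rewrite invr_ge0 ltW.
have h1 : `|(t - t') / A| <= r^-1 * `|t - t'|.
  by rewrite normrM normfV (gtr0_norm A0) mulrC ler_wpM2r.
have h2 : `|t' / B * ((B - A) / A)| <= r^-1 * `|t - t'|.
  rewrite normrM -[leRHS]mul1r ler_pM//.
    by rewrite normrM normfV (gtr0_norm B0) ler_pdivrMr// mul1r.
  by rewrite normrM normfV (gtr0_norm A0) mulrC ler_pM// distrC.
by rewrite (le_trans (ler_normD _ _))//; lra.
Qed.

Let root_cvg t : Num.sqrt (t ^+ 2 + k.+1%:R^-1 ^+ 2) @[k --> \oo] --> `|t|.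
Proof.
rewrite -sqrtr_sqr; apply: continuous_cvg; first exact: sqrt_continuous.
rewrite -[X in _ --> X]addr0; apply: cvgD; first exact: cvg_cst.
rewrite -(mulr0 (0 : R)); under eq_fun do rewrite expr2.
by apply: cvgM; exact: cvg_harmonic.
Qed.

Lemma sabs_cvg t : sabs k.+1%:R^-1 t @[k --> \oo] --> `|t|.
Proof.
rewrite -[X in _ --> X]subr0; apply: cvgB; first exact: root_cvg.
exact: cvg_harmonic.
Qed.

Lemma dsabs_cvg t : dsabs k.+1%:R^-1 t @[k --> \oo] --> Num.sg t.
Proof.
have [->|t0] := eqVneq t 0.
  rewrite sgr0 (_ : (fun k => _) = cst 0); first exact: cvg_cst.
  by apply/funext => k; rewrite /dsabs mul0r.
have -> : Num.sg t = t / `|t|.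
  by rewrite [X in X / _]numEsg mulfK// normr_eq0.
apply: cvgM; first exact: cvg_cst.
by apply: cvgV; [rewrite normr_eq0|exact: root_cvg].
Qed.

Lemma measurable_dsabs r : 0 < r -> measurable_fun [set: R] (dsabs r).
Proof.
move=> r0; apply: continuous_measurable_fun => t.
have [A0 A2 rA tA] := sabs_root t r0.
apply: cvgM; first exact: cvg_id.
apply: cvgV; first by rewrite gt_eqF.
apply: continuous_comp; last exact: sqrt_continuous.
apply: cvgD; last exact: cvg_cst.
by apply: cvgM; exact: cvg_id.
Qed.

Lemma measurable_sabs r : 0 < r -> measurable_fun [set: R] (sabs r).
Proof.
move=> r0; apply: continuous_measurable_fun => t.
apply: cvgB; last exact: cvg_cst.
apply: continuous_comp; last exact: sqrt_continuous.
apply: cvgD; last exact: cvg_cst.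
by apply: cvgM; exact: cvg_id.
Qed.

End SmoothAbs.

Section PositivePart.
Context {R : realType} {n : nat}.
Variable Omega : set 'rV[R]_n.
Hypotheses (oO : open Omega) (bO : bounded_set Omega).
Notation mu := (@lebesgue_rV R n).
Notation L2 := (square_integrable mu Omega).
Notation ip := (inner mu Omega).
Implicit Types (u v phi psi : 'rV[R]_n -> R) (G H : 'rV[R]_n -> 'rV[R]_n).

Let mO : measurable Omega := open_measurable_rV oO.

Lemma test_sabs r phi : 0 < r -> test_function Omega phi ->
  test_function Omega (sabs r \o phi).
Proof.
move=> r0 t; have s := test_smooth t.
apply: (test_function_sub t).
  rewrite (_ : _ \o _ = (Num.sqrt \o (phi * phi + cst (r ^+ 2))) + cst (- r)).
    apply: smoothD; last exact: smooth_cst.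
    apply: smooth_sqrt; first by apply: smoothD; [exact: smoothM|exact: smooth_cst].
    by move=> x; rewrite !fctE -expr2 sabs_pos.
  by apply/funext => x; rewrite !fctE /= /sabs expr2.
move=> x h; apply: subset_closure => /=; apply: contra_neq h => p0 /=.
by rewrite p0 sabs0.
Qed.

Lemma partial_sabs i r phi x : 0 < r -> smooth phi ->
  partial i (sabs r \o phi) x = dsabs r (phi x) * partial i phi x.
Proof.
move=> r0 s.
have sf : smooth (phi * phi + cst (r ^+ 2)).
  by apply: smoothD; [exact: smoothM|exact: smooth_cst].
have f0 y : 0 < (phi * phi + cst (r ^+ 2)) y by rewrite !fctE -expr2 sabs_pos.
rewrite (_ : sabs r \o phi = (Num.sqrt \o (phi * phi + cst (r ^+ 2))) + cst (- r)); last first.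
  by apply/funext => y; rewrite !fctE /= /sabs expr2.
have dc : differentiable (cst (- r) : 'rV[R]_n -> R) x by exact: differentiable_cst.
rewrite partialD//; last exact/smooth_diff/smooth_sqrt.
have dc' : differentiable (cst (r ^+ 2) : 'rV[R]_n -> R) x by exact: differentiable_cst.
have dpp : differentiable (phi * phi) x by apply/smooth_diff/smoothM.
rewrite partial_sqrt// partialD//.
have pc c : partial i (cst c : 'rV[R]_n -> R) x = 0 by rewrite /partial derive_cst.
rewrite !pc !addr0 partialM; [|exact: smooth_diff..].
have [A0 _ _ _] := sabs_root (phi x) r0.
rewrite /dsabs !fctE -expr2; field.
by rewrite gt_eqF.
Qed.

(** On the part where [g] is bounded the Lipschitz bound of [dsabs] gives the
    estimate, and the part where [g] is large contributes little. *)
Lemma dsabs_mul_continuous r v g : 0 < r -> L2 v -> L2 g ->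
  forall e : R, 0 < e -> exists K, 0 <= K /\ forall phi, L2 phi ->
    ip (((dsabs r \o phi) - (dsabs r \o v)) * g) (((dsabs r \o phi) - (dsabs r \o v)) * g)
      <= e + K * ip (phi - v) (phi - v).
Proof.
move=> r0 lv lg e e0.
(* [T k] is [g] truncated at the levels - k and k. *)
pose T (k : nat) x : R := Num.max (- k%:R) (Num.min k%:R (g x)).
have mT k : measurable_fun Omega (T k).
  apply: measurable_maxr; first exact: measurable_cst.
  by apply: measurable_minr; [exact: measurable_cst|case: lg].
have Tg k x : Omega x -> `|T k x| <= `|g x|.
  move=> _; have k0 : 0 <= k%:R :> R by [].
  have := ler_norm (g x); have := ler_norm (- g x); rewrite normrN => h1 h2.
  rewrite ler_norml le_max ge_max le_min ge_min h2 orbT andbT.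
  by apply/andP; split; [apply/orP; right; apply/andP; split|]; lra.
have Tk k x : `|T k x| <= k%:R.
  have k0 : 0 <= k%:R :> R by [].
  by rewrite ler_norml le_max ge_max lexx/= ge_min lexx/= andbT; lra.
have Tc x : Omega x -> T k x @[k --> \oo] --> g x.
  move=> _; apply: cvg_near_cst; exists (Num.truncn `|g x|).+1 => // k /= kx.
  have : `|g x| < k%:R by rewrite (lt_le_trans (truncnS_gt _))// ler_nat.
  rewrite ltr_norml => /andP[h1 h2].
  by rewrite /T min_r ?(ltW h2)// max_r// ltW.
have mg : measurable_fun Omega g by case: lg.
have [_ cT] := L2_dominated_cvg mO mT mg lg Tg Tc.
have e8 : 0 < e / 8 by rewrite divr_gt0.
have [k hk] := filter_ex (cT _ e8).
exists (2 * (2 / r * k%:R) ^+ 2); split; first by rewrite mulr_ge0// sqr_ge0.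
move=> phi lp; set w := _ - _.
have lT : L2 (T k) by apply: (@L2_bnd _ _ _ mu _ mO g _ 1) => // x Ox; rewrite mul1r Tg.
have mw : measurable_fun Omega w.
  by apply: measurable_funB; apply: measurableT_comp; [exact: measurable_dsabs|case: lp|exact: measurable_dsabs|case: lv].
have w2 x : `|w x| <= 2.
  rewrite /w !fctE (le_trans (ler_normB _ _))// -[leRHS]/(1 + 1).
  by rewrite lerD// dsabs_le1.
have lwT : L2 (w * T k) by apply: (@L2_mulb _ _ _ mu _ mO _ _ 2).
have lwg : L2 (w * (g - T k)).
  by apply: (@L2_mulb _ _ _ mu _ mO _ _ 2) => //; exact: L2B.
rewrite [w * g](_ : _ = w * T k + w * (g - T k)); last first.
  by apply/funext => x; rewrite !fctE; ring.
apply: le_trans (ip_sqD mO lwT lwg) _.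
have h1 : ip (w * T k) (w * T k) <= (2 / r * k%:R) ^+ 2 * ip (phi - v) (phi - v).
  have lpv := L2B mO lp lv.
  rewrite -ip_sqZ//; apply: ip_le => //; first exact: L2Z.
  move=> x _; have rk : 0 <= 2 / r by rewrite divr_ge0// ltW.
  have -> : `|((2 / r * k%:R) *: (phi - v)) x| = 2 / r * `|phi x - v x| * k%:R.
    transitivity (`|(2 / r * k%:R) * (phi x - v x)|) => //.
    by rewrite 2!normrM (ger0_norm rk) (ger0_norm (ler0n _ _)); ring.
  have -> : `|(w * T k) x| = `|w x| * `|T k x| by exact: normrM.
  by rewrite ler_pM//; exact: dsabs_lipschitz.
have h2 : ip (w * (g - T k)) (w * (g - T k)) <= 4 * ip (T k - g) (T k - g).
  rewrite (ip_sq_subC mO lT lg) (_ : 4 = 2 ^+ 2); last by rewrite -natrX.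
  have lgT := L2B mO lg lT.
  rewrite -ip_sqZ//; apply: ip_le => //; first exact: L2Z.
  by move=> x _; rewrite !fctE !normrM ler_wpM2r// (le_trans (w2 x))// ler_norm.
by lra.
Qed.

(** Along test functions phi tending to v the gradient of [sabs r \o phi] is
    dsabs(phi) grad phi; its distance to dsabs(v) G splits into
    dsabs(phi) (grad phi - G) and (dsabs(phi) - dsabs(v)) G. *)
Lemma strong_grad_sabs r v G : 0 < r -> strong_grad Omega v G ->
  strong_grad Omega (sabs r \o v) (fun x => dsabs r (v x) *: G x).
Proof.
move=> r0 [lv lG vG].
have msv w : L2 w -> L2 (sabs r \o w).
  move=> lw; apply: (@L2_bnd _ _ _ mu _ mO w _ 1) => //.
    by apply: measurableT_comp; [exact: measurable_sabs|case: lw].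
  by move=> x _; rewrite mul1r /=; exact: sabs_le.
have mds w f : L2 w -> L2 f -> L2 ((dsabs r \o w) * f).
  move=> lw lf; apply: (@L2_mulb _ _ _ mu _ mO _ _ 1) => //.
    by apply: measurableT_comp; [exact: measurable_dsabs|case: lw].
  by move=> x _; exact: dsabs_le1.
have cE i : component (fun x => dsabs r (v x) *: G x) i = (dsabs r \o v) * component G i.
  by apply/funext => x; rewrite /component mxE.
split=> [|i|e e0]; [exact: msv|by rewrite cE; exact: mds|].
have e4 : 0 < e / 8 by rewrite divr_gt0.
have /choice[K HK] i := dsabs_mul_continuous r0 lv (lG i) e4.
pose S := \sum_i K i.
have KS i : K i <= S.
  by rewrite /S (bigD1 i)//= lerDl sumr_ge0// => j _; have [] := HK j.
have S0 : 0 <= S by apply: sumr_ge0 => j _; have [] := HK j.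
have S4 : 0 < 8 * (S + 1) by rewrite mulr_gt0// ltr_wpDl.
have d0 : 0 < e / (8 * (S + 1)) by rewrite divr_gt0.
have [phi [t pv pG]] := vG _ d0.
have dle : e / (8 * (S + 1)) <= e / 8.
  rewrite ler_pM2l// lef_pV2 ?posrE//; lra.
have Sd : S * (e / (8 * (S + 1))) <= e / 8.
  rewrite mulrCA ler_pM2l// ler_pdivrMr//; lra.
have [l s] := (test_L2 oO bO t, test_smooth t).
exists (sabs r \o phi); split=> [||i]; first exact: test_sabs.
- apply: (@le_lt_trans _ _ (ip (phi - v) (phi - v))); last by lra.
  apply: ip_le => //; [|exact: L2B|].
    by apply: L2B => //; exact: msv.
  by move=> x _; rewrite !fctE; exact: sabs_lipschitz.
- have lp := test_L2 oO bO (test_partial i t).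
  have -> : partial i (sabs r \o phi) = (dsabs r \o phi) * partial i phi.
    by apply/funext => x; rewrite partial_sabs.
  rewrite cE (_ : _ - _ = (dsabs r \o phi) * (partial i phi - component G i) +
     ((dsabs r \o phi) - (dsabs r \o v)) * component G i); last first.
    by apply/funext => x; rewrite !fctE; ring.
  have lpG := L2B mO lp (lG i).
  have l2 : L2 (((dsabs r \o phi) - (dsabs r \o v)) * component G i).
    by rewrite mulrBl; apply: L2B => //; exact: mds.
  apply: le_lt_trans (ip_sqD mO (mds _ _ l lpG) l2) _.
  have h1 : ip ((dsabs r \o phi) * (partial i phi - component G i))
    ((dsabs r \o phi) * (partial i phi - component G i)) <= e / (8 * (S + 1)).
    apply: le_trans (ltW (pG i)); apply: ip_le => //; first exact: mds.
    by move=> x _; rewrite !fctE normrM ler_piMl// dsabs_le1.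
  have [Ki0 /(_ _ l) h2] := HK i.
  have h3 := ler_wpM2l Ki0 (ltW pv).
  have h4 := ler_wpM2r (ltW d0) (KS i).
  by move: h1 h2 h3 h4 Sd dle; set a := e / (8 * (S + 1)); lra.
Qed.

(** Dominated convergence as r tends to 0: [dsabs r] tends to the sign
    function, with value 0 at 0. *)
Lemma strong_grad_abs v G : strong_grad Omega v G ->
  strong_grad Omega (fun x => `|v x|) (fun x => Num.sg (v x) *: G x).
Proof.
move=> sG; have [lv lG _] := sG.
have mv : measurable_fun Omega v by case: lv.
have r0 k : 0 < k.+1%:R^-1 :> R by rewrite invr_gt0.
have msg : measurable_fun Omega (fun x => Num.sg (v x)).
  apply: (@measurable_fun_cvg _ _ _ _ (fun k => dsabs k.+1%:R^-1 \o v)) => [k|x _].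
    by apply: measurableT_comp => //; exact: measurable_dsabs.
  exact: dsabs_cvg.
have cE i : component (fun x => Num.sg (v x) *: G x) i = (fun x => Num.sg (v x)) * component G i.
  by apply/funext => x; rewrite /component mxE.
have [lav cav] : L2 (fun x => `|v x|) /\ forall e : R, 0 < e -> \forall k \near \oo,
    ip (sabs k.+1%:R^-1 \o v - (fun x => `|v x|)) (sabs k.+1%:R^-1 \o v - (fun x => `|v x|)) < e.
  apply: (L2_dominated_cvg mO _ _ lv).
  - by move=> k; apply: measurableT_comp => //; exact: measurable_sabs.
  - exact: measurableT_comp.
  - by move=> k x _; exact: sabs_le.
  - by move=> x _; exact: sabs_cvg.
have cG i : L2 (component (fun x => Num.sg (v x) *: G x) i) /\ forall e : R, 0 < e ->
    \forall k \near \oo,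
    ip ((dsabs k.+1%:R^-1 \o v) * component G i - component (fun x => Num.sg (v x) *: G x) i)
       ((dsabs k.+1%:R^-1 \o v) * component G i - component (fun x => Num.sg (v x) *: G x) i) < e.
  have mGi : measurable_fun Omega (component G i) by case: (lG i).
  rewrite cE; apply: (L2_dominated_cvg mO _ _ (lG i)).
  - by move=> k; apply: measurable_funM => //; apply: measurableT_comp => //; exact: measurable_dsabs.
  - exact: measurable_funM.
  - by move=> k x _; rewrite normrM ler_piMl// dsabs_le1.
  - by move=> x _; apply: cvgM; [exact: dsabs_cvg|exact: cvg_cst].
apply: strong_grad_closed => // [i|e e0]; first by have [] := cG i.
have nG : \forall k \near \oo, forall i,
  ip ((dsabs k.+1%:R^-1 \o v) * component G i - component (fun x => Num.sg (v x) *: G x) i)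
     ((dsabs k.+1%:R^-1 \o v) * component G i - component (fun x => Num.sg (v x) *: G x) i) < e.
  by apply: near_all_ord => i; have [_] := cG i; apply.
have [k [h1 h2]] := filter_ex (filterI (cav _ e0) nG).
exists (sabs k.+1%:R^-1 \o v), (fun x => dsabs k.+1%:R^-1 (v x) *: G x); split=> // [|i].
  exact: strong_grad_sabs.
have -> : component (fun x => dsabs k.+1%:R^-1 (v x) *: G x) i =
    (dsabs k.+1%:R^-1 \o v) * component G i.
  by apply/funext => x; rewrite /component mxE.
exact: h2.
Qed.

(** max(v, 0) = (|v| + v) / 2. *)
Lemma strong_grad_pos v G : strong_grad Omega v G ->
  strong_grad Omega (fun x => Num.max (v x) 0)
    (fun x => (2^-1 * (Num.sg (v x) + 1)) *: G x).
Proof.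
move=> sG; have := strong_gradZ oO bO 2^-1 (strong_gradD oO bO (strong_grad_abs sG) sG).
congr strong_grad; apply/funext => x.
  rewrite !fctE -[_ *: _]/(_ * _) maxr_absE subr0 addr0; lra.
by rewrite !fctE scalerDr !scalerA -scalerDl; congr (_ *: _); ring.
Qed.

End PositivePart.

(** * Convex minimisation and the truncated power *)

Section ConvexMinimization.
Context {R : realType} {V : lmodType R}.
Variables (S : set V) (a : V -> V -> R) (F : V -> R) (C : R).
Hypotheses (S0 : S 0) (SD : forall u v, S u -> S v -> S (u + v))
  (SZ : forall (c : R) u, S u -> S (c *: u)).
Hypotheses (aC : forall u v, a u v = a v u)
  (aD : forall u v w, S u -> S v -> S w -> a (u + v) w = a u w + a v w)
  (aZ : forall (c : R) u v, S u -> S v -> a (c *: u) v = c * a u v)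
  (a_ge0 : forall u, 0 <= a u u).
Hypothesis complete : forall f : nat -> V, (forall k, S (f k)) ->
  (forall e : R, 0 < e -> exists K, forall j k, (K <= j)%N -> (K <= k)%N ->
    a (f j - f k) (f j - f k) < e) ->
  exists u, S u /\ forall e : R, 0 < e -> exists K, forall k, (K <= k)%N ->
    a (f k - u) (f k - u) < e.
Hypotheses (F_concave : forall u v, S u -> S v -> F u + F v <= 2 * F (2^-1 *: (u + v)))
  (C0 : 0 < C)
  (F_lipschitz : forall u v, S u -> S v -> (F u - F v) ^+ 2 <= C * a (u - v) (u - v)).

Let J u := 2^-1 * a u u - F u.

Let SN u : S u -> S (- u). Proof. by move=> ?; rewrite -scaleN1r; exact: SZ. Qed.
Let SB u v : S u -> S v -> S (u - v). Proof. by move=> ? ?; apply/SD/SN. Qed.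

Let aSqD u v : S u -> S v -> a (u + v) (u + v) = a u u + 2 * a u v + a v v.
Proof.
by move=> Su Sv; rewrite aD ?(aC _ (u + v)) ?aD//; [rewrite (aC v u); ring|exact: SD..].
Qed.

Let aSqZ (c : R) u : S u -> a (c *: u) (c *: u) = c ^+ 2 * a u u.
Proof.
by move=> Su; have Sc := SZ c Su; rewrite aZ// aC aZ// mulrA.
Qed.

Let aNr u v : S u -> S v -> a u (- v) = - a u v.
Proof. by move=> Su Sv; rewrite aC -scaleN1r aZ// mulN1r aC. Qed.

Let aSqB u v : S u -> S v -> a (u - v) (u - v) = a u u - 2 * a u v + a v v.
Proof.
move=> Su Sv; rewrite aSqD//; last exact: SN.
rewrite aNr// -[X in _ + _ + X](_ : a v v = _); first by ring.
by rewrite -scaleN1r aSqZ// sqrrN expr1n mul1r.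
Qed.

(** The Lipschitz bound makes the concave part of sublinear growth, so [J] is
    bounded below and coercive. *)
Let J_lower u : S u -> 4^-1 * a u u - (C + F 0) <= J u.
Proof.
move=> Su; have := F_lipschitz Su S0; rewrite subr0 /J => h.
have A0 := a_ge0 u; set A := a u u in h A0 *; set x := F u - F 0 in h.
suff : x <= 4^-1 * A + C by rewrite /x; lra.
rewrite leNgt; apply/negP => h1.
have h2 : 0 <= 4^-1 * A + C by rewrite addr_ge0// ?mulr_ge0// ltW.
have : (4^-1 * A + C) ^+ 2 < x ^+ 2 by rewrite ltrXn2r// ?nnegrE// (le_trans h2)// ltW.
have := sqr_ge0 (4^-1 * A - C); nra.
Qed.

(** By the parallelogram law, and since [F] at a midpoint is at least the mean of
    its values, two elements at which [J] is nearly minimal are close to each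
    other; a minimising sequence is therefore Cauchy. *)
Theorem quadratic_concave_min : exists2 u, S u & forall v, S v -> J u <= J v.
Proof.
pose E := [set J u | u in S].
have E0 : E !=set0 by exists (J 0), 0.
have lE : has_lbound E.
  exists (- (C + F 0)) => _ [u Su <-]; apply: le_trans (J_lower Su).
  by rewrite lerDr mulr_ge0.
have hE : has_inf E by [].
pose m := inf E.
have mJ u : S u -> m <= J u by move=> Su; apply: ge_inf => //; exists u.
have [eps [eps0 eps1 inv]] : exists eps : nat -> R, [/\ forall k, 0 < eps k,
    forall k, eps k <= 1 & forall e : R, 0 < e -> exists K, forall k, (K <= k)%N -> eps k < e].
  exists (fun k => k.+1%:R^-1); split=> [k|k|e e0]; first by rewrite invr_gt0.
    by rewrite invf_le1// ler1n.
  exists (Num.truncn e^-1) => k Kk.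
  by rewrite invf_plt ?posrE// (lt_le_trans (truncnS_gt _))// ler_nat.
have /choice[f Hf] : forall k : nat, exists u, S u /\ J u < m + eps k.
  by move=> k; have [_ [u Su <-] Ju] := inf_adherent (eps0 k) hE; exists u.
have Sf k : S (f k) by have [] := Hf k.
have Jf k : J (f k) < m + eps k by have [] := Hf k.
have par u v : S u -> S v -> a (u - v) (u - v) <= 4 * (J u - m) + 4 * (J v - m).
  move=> Su Sv; have := mJ _ (SZ 2^-1 (SD Su Sv)); have := F_concave Su Sv.
  rewrite /J aSqZ; last exact: SD.
  by rewrite aSqD// aSqB// expr2; lra.
have [|u [Su uf]] := complete Sf.
  move=> e e0; have [K HK] := inv (e / 8) (divr_gt0 e0 (ltr0Sn R 7)).
  exists K => j k Kj Kk; apply: le_lt_trans (par _ _ (Sf j) (Sf k)) _.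
  have small i : (K <= i)%N -> J (f i) - m < e / 8.
    by move=> Ki; rewrite ltrBlDl (lt_trans (Jf i))// ltrD2l HK.
  by have := small _ Kj; have := small _ Kk; lra.
exists u => // v Sv; apply: le_trans (mJ _ Sv); apply/ler_addgt0Pr => e e0.
pose B := 4 * (m + 1 + (C + F 0)) + 1.
have fB k : a (f k) (f k) <= B - 1.
  have := J_lower (Sf k); have := Jf k.
  have := eps1 k.
  by rewrite /B; lra.
have B0 : 0 < B by have := fB 0%N; have := a_ge0 (f 0%N); lra.
pose d := e / B.
have d0 : 0 < d by rewrite divr_gt0.
have dB : d * B = e by rewrite divfK// gt_eqF.
have dd0 : 0 < 2^-1 * (1 + d^-1) by rewrite mulr_gt0// addr_gt0// invr_gt0.
pose e1 := Num.min (e / 4 / (2^-1 * (1 + d^-1))) ((e / 8) ^+ 2 / C).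
have e8 : 0 < e / 8 by rewrite divr_gt0.
have e10 : 0 < e1.
  by rewrite lt_min !divr_gt0// exprn_gt0.
have [K1 HK1] := uf _ e10; have [K2 HK2] := inv _ e8.
pose k := maxn K1 K2.
have := HK1 k (leq_maxl _ _); have ik := HK2 k (leq_maxr _ _); have Jk := Jf k.
set y := f k - u; have Sy : S y by exact: SB.
rewrite lt_min => /andP[].
rewrite ltr_pdivlMr// => y1; rewrite ltr_pdivlMr// => y2.
have uE : u = f k - y by rewrite /y subKr.
have au : a u u = a (f k) (f k) - 2 * a (f k) y + a y y by rewrite {1 2}uE aSqB.
(* Young's inequality. Passing to the limit in [J] needs [a u u] to be close to
   [a (f k) (f k)], and the latter is bounded by [B]. *)
have young : - (2 * a (f k) y) <= d * a (f k) (f k) + d^-1 * a y y.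
  have := a_ge0 (d *: f k + y).
  rewrite aSqD//; last exact: SZ.
  rewrite aSqZ// aZ// => h; rewrite -(ler_pM2l d0) mulrDr.
  by rewrite (mulrA d d^-1) mulfV ?gt_eqF// mul1r; lra.
have Fy : F (f k) - F u <= e / 8.
  rewrite leNgt; apply/negP => h.
  have : (e / 8) ^+ 2 < (F (f k) - F u) ^+ 2.
    by rewrite ltrXn2r ?nnegrE ?(ltW e8)// (le_trans (ltW e8))// ltW.
  by have := F_lipschitz (Sf k) Su; rewrite -/y; lra.
have h1 := ler_wpM2l (ltW d0) (fB k).
have h2 : a y y + d^-1 * a y y < e / 2 by move: y1; lra.
by rewrite /J in Jk *; rewrite au; lra.
Qed.

End ConvexMinimization.

Section TruncatedPower.
Context {R : realType}.
Variables (al : R).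
Hypothesis al01 : 0 < al < 1.

(** [sprim p] is the primitive of [spow p], up to a constant: it is
    s^(1-al) / (1-al) for s >= p and its tangent at p below. *)
Definition spow (p s : R) : R := Num.max s p `^ (- al).
Definition sprim (p s : R) : R :=
  (Num.max s p) `^ (1 - al) / (1 - al) + p `^ (- al) * (s - Num.max s p).

Lemma powR_antitone (s t : R) : 0 < s -> s <= t -> t `^ (- al) <= s `^ (- al).
Proof.
move=> s0 st; have t0 : 0 < t by exact: lt_le_trans st.
have /andP[a0 _] := al01.
rewrite !powRN lef_pV2 ?posrE ?powR_gt0//.
by apply: ge0_ler_powR => //; rewrite ?nnegrE ltW.
Qed.

(** Concavity of [s `^ (1 - al)]; dividing by [s `^ (1 - al)] reduces it to
    Bernoulli's inequality. *)
Lemma powR_tangent (s t : R) : 0 < s -> 0 < t ->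
  t `^ (1 - al) - s `^ (1 - al) <= (1 - al) * (s `^ (- al) * (t - s)).
Proof.
move=> s0 t0; have /andP[a0 a1] := al01; set b := 1 - al.
have b0 : 0 < b by rewrite subr_gt0.
pose z := t / s; have z0 : 0 < z by rewrite divr_gt0.
(* With z = t / s and w = al + b z, averaging ln x <= x - 1 at x = z / w and
   x = 1 / w with the weights b and al gives b ln z <= ln w, that is,
   z^b <= 1 + b (z - 1). *)
have ln_le (x : R) : 0 < x -> ln x <= x - 1.
  by move=> x0; rewrite lerBrDl -[leRHS]lnK ?posrE// expR_ge1Dx.
pose w := 1 + b * (z - 1).
have w0 : 0 < w.
  have -> : w = al + b * z by rewrite /w /b; ring.
  by rewrite addr_gt0// mulr_gt0.
have h : b * ln z <= ln w.
  have h1 := ler_wpM2l (ltW b0) (ln_le _ (divr_gt0 z0 w0)).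
  have h2 := ler_wpM2l (ltW a0) (ln_le _ (divr_gt0 ltr01 w0)).
  rewrite ln_div ?posrE// in h1; rewrite ln_div ?posrE// ln1 in h2.
  have e : b * (z / w - 1) + al * (1 / w - 1) = 0.
    rewrite (_ : _ + _ = (b * z + al - w) / w); last by rewrite /b; field; rewrite gt_eqF.
    by rewrite (_ : b * z + al - w = 0) ?mul0r// /w /b; ring.
  by move: h1 h2; rewrite /b; rewrite /b in e; lra.
have zb : z `^ b <= w.
  by rewrite /powR gt_eqF// -[leRHS]lnK ?posrE// ler_expR.
have tE : t = s * z by rewrite /z mulrC divfK// gt_eqF.
have sb : s `^ b = s `^ (- al) * s.
  have -> : b = - al + 1 by rewrite /b addrC.
  rewrite powRD; last by rewrite (gt_eqF s0) implybT.
  by rewrite powRr1// ltW.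
rewrite tE powRM ?(ltW s0) ?(ltW z0)// sb.
have k0 : 0 < s `^ (- al) * s by rewrite mulr_gt0// powR_gt0.
by have := ler_wpM2l (ltW k0) zb; rewrite /w; lra.
Qed.

Lemma spow_ge0 p s : 0 <= spow p s.
Proof. exact: powR_ge0. Qed.

Lemma spow_le p s : 0 < p -> spow p s <= p `^ (- al).
Proof. by move=> p0; apply: powR_antitone => //; rewrite le_max lexx orbT. Qed.

(** The supergradient inequality contains all that is used of the primitive: it
    gives the Lipschitz bound, concavity and the first variation. *)
Lemma sprim_supergrad p s t : 0 < p -> sprim p t - sprim p s <= spow p s * (t - s).
Proof.
move=> p0; rewrite /sprim /spow; have /andP[a0 a1] := al01.
set ms := Num.max s p; set mt := Num.max t p.
have ms0 : 0 < ms by rewrite lt_max p0 orbT.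
have mt0 : 0 < mt by rewrite lt_max p0 orbT.
have b0 : 0 < 1 - al by lra.
have h := powR_tangent ms0 mt0.
have h1 : (mt `^ (1 - al) - ms `^ (1 - al)) / (1 - al) <= ms `^ (- al) * (mt - ms).
  by rewrite ler_pdivrMr// mulrC.
have pm : ms `^ (- al) <= p `^ (- al) by exact: spow_le.
have tm : t <= mt by rewrite le_max lexx.
have h2 : (p `^ (- al) - ms `^ (- al)) * ((t - mt) - (s - ms)) <= 0.
  have [sp|sp] := ltP s p.
    have -> : ms = p by rewrite /ms max_r// ltW.
    by rewrite subrr mul0r.
  have -> : s - ms = 0 by rewrite /ms max_l// subrr.
  rewrite subr0.
  by rewrite mulr_ge0_le0// ?subr_ge0// subr_le0.
by move: h1; rewrite mulrBl; lra.
Qed.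

Lemma sprim_lipschitz p s t : 0 < p -> `|sprim p s - sprim p t| <= p `^ (- al) * `|s - t|.
Proof.
move=> p0; have h1 := sprim_supergrad s t p0; have h2 := sprim_supergrad t s p0.
have key u w : spow p u * w <= p `^ (- al) * `|w|.
  apply: (@le_trans _ _ (spow p u * `|w|)).
    by rewrite ler_wpM2l ?spow_ge0// ler_norm.
  by rewrite ler_wpM2r// spow_le.
rewrite ler_norml; apply/andP; split.
  by have := key s (t - s); rewrite distrC; lra.
by have := key t (s - t); lra.
Qed.

Lemma sprim_concave p s t : 0 < p ->
  sprim p s + sprim p t <= 2 * sprim p (2^-1 * (s + t)).
Proof.
move=> p0; have h1 := sprim_supergrad (2^-1 * (s + t)) s p0.
have h2 := sprim_supergrad (2^-1 * (s + t)) t p0.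
have e : spow p (2^-1 * (s + t)) * (s - 2^-1 * (s + t)) +
  spow p (2^-1 * (s + t)) * (t - 2^-1 * (s + t)) = 0 by field.
lra.
Qed.

End TruncatedPower.

(** * The energy space and the truncated equation *)

Section Energy.
Context {R : realType} {n : nat}.
Variable Omega : set 'rV[R]_n.
Hypotheses (oO : open Omega) (bO : bounded_set Omega).
Notation mu := (@lebesgue_rV R n).
Notation L2 := (square_integrable mu Omega).
Notation ip := (inner mu Omega).
Notation H10 := (H10 Omega).
Notation strong_grad := (strong_grad Omega).
Implicit Types (u v w : 'rV[R]_n -> R) (G H : 'rV[R]_n -> 'rV[R]_n).

Let mO : measurable Omega := open_measurable_rV oO.

Definition energy u v :=
  \sum_i ip (component (wgrad Omega u) i) (component (wgrad Omega v) i).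

Let wg_L2 u G i : strong_grad u G -> L2 (component (wgrad Omega u) i).
Proof.
move=> sG; have [_ lG _] := H10_strong_grad oO bO (strong_grad_H10 oO bO sG).
exact: lG.
Qed.

(** The gradient in the definition is an arbitrary choice; here it is replaced by
    an explicit one, such as that of a sum or of an absolute value. *)
Lemma energyE u G v H : strong_grad u G -> strong_grad v H ->
  energy u v = \sum_i ip (component G i) (component H i).
Proof.
move=> sG sH; apply: eq_bigr => i _; have [_ lG _] := sG; have [_ lH _] := sH.
by apply: ip_ae => //; [exact: wg_L2 sG|exact: wg_L2 sH|exact: strong_grad_wgrad..].
Qed.

Lemma energyC u v : energy u v = energy v u.
Proof. by apply: eq_bigr => i _; rewrite ipC. Qed.

Lemma energy_ge0 u : 0 <= energy u u.
Proof. by apply: sumr_ge0 => i _; exact: ip_ge0. Qed.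

Lemma H10D u v : H10 u -> H10 v -> H10 (u + v).
Proof.
move=> /(H10P oO bO)[G sG] /(H10P oO bO)[H sH]; apply/(H10P oO bO).
by exists (G + H); exact: strong_gradD.
Qed.

Lemma H10Z c u : H10 u -> H10 (c *: u).
Proof.
move=> /(H10P oO bO)[G sG]; apply/(H10P oO bO).
by exists (c *: G); exact: strong_gradZ.
Qed.

Lemma H10N u : H10 u -> H10 (- u).
Proof. by move=> Hu; rewrite -scaleN1r; exact: H10Z. Qed.

Lemma H10B u v : H10 u -> H10 v -> H10 (u - v).
Proof. by move=> Hu Hv; apply/H10D/H10N. Qed.

Lemma H10_0 : H10 0.
Proof. by apply/(H10P oO bO); eexists; exact: strong_grad_test (test_0 Omega). Qed.

Lemma H10_L2 u : H10 u -> L2 u.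
Proof. by move=> /(H10P oO bO)[G [lu _ _]]. Qed.

Lemma H10_measurable u : H10 u -> measurable_fun Omega u.
Proof. by move=> /H10_L2 []. Qed.

Lemma energyDl u v w : H10 u -> H10 v -> H10 w ->
  energy (u + v) w = energy u w + energy v w.
Proof.
move=> /(H10P oO bO)[G sG] /(H10P oO bO)[H sH] /(H10P oO bO)[I sI].
rewrite (energyE (strong_gradD oO bO sG sH) sI) (energyE sG sI) (energyE sH sI).
rewrite -big_split; apply: eq_bigr => i _; rewrite componentD.
have [_ lG _] := sG; have [_ lH _] := sH; have [_ lI _] := sI.
by rewrite ipDl.
Qed.

Lemma energyZl c u w : H10 u -> H10 w -> energy (c *: u) w = c * energy u w.
Proof.
move=> /(H10P oO bO)[G sG] /(H10P oO bO)[I sI].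
rewrite (energyE (strong_gradZ oO bO c sG) sI) (energyE sG sI) mulr_sumr.
apply: eq_bigr => i _; rewrite componentZ.
have [_ lG _] := sG; have [_ lI _] := sI.
by rewrite ipZl.
Qed.

Lemma energyDr u v w : H10 u -> H10 v -> H10 w ->
  energy w (u + v) = energy w u + energy w v.
Proof. by move=> *; rewrite !(energyC w) energyDl. Qed.

Lemma energyZr c u w : H10 u -> H10 w -> energy w (c *: u) = c * energy w u.
Proof. by move=> *; rewrite !(energyC w) energyZl. Qed.

Lemma energyBl u v w : H10 u -> H10 v -> H10 w ->
  energy (u - v) w = energy u w - energy v w.
Proof.
move=> Hu Hv Hw; have HN := H10N Hv.
by rewrite energyDl// -scaleN1r energyZl// mulN1r.
Qed.

Lemma energy_sqDZ u v t : H10 u -> H10 v ->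
  energy (u + t *: v) (u + t *: v) =
  energy u u + 2 * t * energy u v + t ^+ 2 * energy v v.
Proof.
move=> Hu Hv; have Htv := H10Z t Hv.
rewrite (energyDl Hu Htv (H10D Hu Htv)) (energyDr Hu Htv Hu) (energyDr Hu Htv Htv).
rewrite (energyZr t Hv Hu) (energyZl t Hv Hu) (energyZl t Hv Htv) (energyZr t Hv Hv).
rewrite (energyC v u); move: (energy u u) (energy u v) (energy v v) => a b c.
by ring.
Qed.

Lemma energy_cs u v : H10 u -> H10 v -> energy u v ^+ 2 <= energy u u * energy v v.
Proof.
move=> Hu Hv; apply: discriminant_le; [exact: energy_ge0..|move=> t].
by rewrite -energy_sqDZ//; exact: energy_ge0.
Qed.

Lemma int_grad_energy u v : H10 u -> H10 v -> int_grad Omega u v = (energy u v)%:E.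
Proof.
move=> Hu Hv; have [_ lG _] := H10_strong_grad oO bO Hu.
have [_ lH _] := H10_strong_grad oO bO Hv.
rewrite /int_grad /energy -sumEFin.
under eq_integral do rewrite -sumEFin.
rewrite (@integral_sum _ _ _ mu Omega mO _
  (fun i x => (wgrad Omega u x ord0 i * wgrad Omega v x ord0 i)%:E)); last first.
  by move=> i; have h := L2_mul mO (lG i) (lH i); exact: h.
by apply: eq_bigr => i _; rewrite -(ip_integral oO (lG i) (lH i)).
Qed.

Lemma energy_poincare : (0 < n)%N ->
  exists2 C, 0 < C & forall u, H10 u -> ip u u <= C * energy u u.
Proof.
move=> n0; pose i0 := Ordinal n0.
have [C C0 HC] := poincare oO bO; exists C => // u Hu.
have sG := H10_strong_grad oO bO Hu.
apply: le_trans (HC i0 _ _ sG) _; rewrite ler_wpM2l//; first exact: ltW.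
by rewrite /energy (bigD1 i0)//= lerDl sumr_ge0// => i _; exact: ip_ge0.
Qed.

Lemma energy_eq0 u : (0 < n)%N -> H10 u -> energy u u <= 0 ->
  {ae mu, forall x, Omega x -> u x = 0}.
Proof.
move=> n0 Hu u0; have [C C0 HC] := energy_poincare n0.
apply: ip_sq0_ae => //; first exact: H10_L2.
apply/eqP; rewrite eq_le ip_ge0 andbT (le_trans (HC _ Hu))//.
by rewrite mulr_ge0_le0// ltW.
Qed.

(** By the Poincare inequality the functions converge along with their
    gradients, and strong gradients are closed. *)
Lemma energy_complete (f : nat -> 'rV[R]_n -> R) : (0 < n)%N -> (forall k, H10 (f k)) ->
  (forall e : R, 0 < e -> exists K, forall j k, (K <= j)%N -> (K <= k)%N ->
    energy (f j - f k) (f j - f k) < e) ->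
  exists u, H10 u /\ forall e : R, 0 < e -> exists K, forall k, (K <= k)%N ->
    energy (f k - u) (f k - u) < e.
Proof.
move=> n0 Hf cf; have [C C0 HC] := energy_poincare n0.
have lf k := H10_L2 (Hf k).
have sf k := H10_strong_grad oO bO (Hf k).
have lg k i : L2 (component (wgrad Omega (f k)) i) by have [_ lG _] := sf k.
have sB j k : energy (f j - f k) (f j - f k) =
    \sum_i ip (component (wgrad Omega (f j)) i - component (wgrad Omega (f k)) i)
       (component (wgrad Omega (f j)) i - component (wgrad Omega (f k)) i).
  have := strong_gradD oO bO (sf j) (strong_gradZ oO bO (-1) (sf k)).
  rewrite scaleN1r => s; rewrite (energyE s s); apply: eq_bigr => i _.
  by rewrite componentD componentZ scaleN1r.
have [u [lu fu]] : exists u, L2 u /\ forall e : R, 0 < e -> exists K, forall k, (K <= k)%N ->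
    ip (f k - u) (f k - u) < e.
  apply: L2_complete => // e e0; have [K HK] := cf _ (divr_gt0 e0 C0).
  exists K => j k Kj Kk; apply: le_lt_trans (HC _ (H10B (Hf j) (Hf k))) _.
  by rewrite mulrC -ltr_pdivlMr// HK.
have /choice[g Hg] : forall i, exists g, L2 g /\ forall e : R, 0 < e ->
    exists K, forall k, (K <= k)%N ->
    ip (component (wgrad Omega (f k)) i - g) (component (wgrad Omega (f k)) i - g) < e.
  move=> i; apply: L2_complete => // e e0; have [K HK] := cf _ e0.
  exists K => j k Kj Kk; apply: le_lt_trans (HK _ _ Kj Kk).
  by rewrite sB (bigD1 i)//= lerDl sumr_ge0// => l _; exact: ip_ge0.
pose G : 'rV[R]_n -> 'rV[R]_n := fun x => \row_i g i x.
have GE i : component G i = g i by apply/funext => x; rewrite /component mxE.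
have near_g (e : R) : 0 < e -> \forall k \near \oo, forall i,
    ip (component (wgrad Omega (f k)) i - g i) (component (wgrad Omega (f k)) i - g i) < e.
  move=> e0; apply: near_all_ord => i; have [_ /(_ e e0)[K HK]] := Hg i.
  by exists K.
have near_f (e : R) : 0 < e -> \forall k \near \oo, ip (f k - u) (f k - u) < e.
  by move=> e0; have [K HK] := fu _ e0; exists K.
have sG : strong_grad u G.
  apply: strong_grad_closed => // [i|e e0]; first by rewrite GE; have [] := Hg i.
  have [k [h1 h2]] := filter_ex (filterI (near_f _ e0) (near_g _ e0)).
  by exists (f k), (wgrad Omega (f k)); split=> // i; rewrite GE.
exists u; split; first exact: strong_grad_H10 sG.
move=> e e0; have en : 0 < e / n.+1%:R by rewrite divr_gt0.
have [K _ HK] := near_g _ en; exists K => k Kk.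
have := strong_gradD oO bO (sf k) (strong_gradZ oO bO (-1) sG).
rewrite scaleN1r => s; rewrite (energyE s s).
apply: (@le_lt_trans _ _ (\sum_(i < n) (e / n.+1%:R))).
  apply: ler_sum => i _; rewrite componentD componentZ scaleN1r GE.
  exact/ltW/HK.
rewrite sumr_const card_ord -[X in X < _]mulr_natr mulrAC ltr_pdivrMr//.
by rewrite ltr_pM2l// ltr_nat.
Qed.

End Energy.

Lemma variation_le {R : realFieldType} (t e0 e1 e2 I F0 F1 : R) : t * I <= F1 - F0 ->
  2^-1 * e0 - F0 <= 2^-1 * (e0 + 2 * t * e1 + t ^+ 2 * e2) - F1 ->
  t * I <= t * (e1 + 2^-1 * t * e2).
Proof. by move=> *; lra. Qed.

Section SingularProblem.
Context {R : realType} {n : nat}.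
Variables (Omega : set 'rV[R]_n) (al : R).
Hypotheses (oO : open Omega) (bO : bounded_set Omega) (al01 : 0 < al < 1) (n0 : (0 < n)%N).
Notation mu := (@lebesgue_rV R n).
Notation H10 := (H10 Omega).
Notation energy := (energy Omega).
Implicit Types (u v w : 'rV[R]_n -> R).

Let mO : measurable Omega := open_measurable_rV oO.
Notation intbl f := (mu.-integrable Omega (EFin \o f)).

Variables (p : 'rV[R]_n -> R) (K : R).
Hypotheses (mp : measurable_fun Omega p) (p0 : forall x, 0 < p x) (K0 : 0 < K).
(** The bound of the singular weight by the energy makes the integral of the
    concave primitive finite and Lipschitz for the energy norm. *)
Hypothesis weight : forall v, H10 v ->
  intbl (fun x => p x `^ (- al) * `|v x|) /\
  (\int[mu]_(x in Omega) (p x `^ (- al) * `|v x|)) ^+ 2 <= K * energy v v.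

Lemma measurable_powR_fun (f : 'rV[R]_n -> R) (b : R) : measurable_fun Omega f ->
  measurable_fun Omega (fun x => f x `^ b).
Proof. by move=> mf; have h := measurableT_comp (measurable_powR b) mf; exact: h. Qed.

Lemma measurable_spow v : measurable_fun Omega v ->
  measurable_fun Omega (fun x => spow al (p x) (v x)).
Proof. by move=> mv; apply: measurable_powR_fun; exact: measurable_maxr. Qed.

Lemma measurable_sprim v : measurable_fun Omega v ->
  measurable_fun Omega (fun x => sprim al (p x) (v x)).
Proof.
move=> mv; have mm : measurable_fun Omega (fun x => Num.max (v x) (p x)).
  exact: measurable_maxr.
apply: measurable_funD.
  apply: measurable_funM; [exact: measurable_powR_fun|exact: measurable_cst].
by apply: measurable_funM; [exact: measurable_powR_fun|exact: measurable_funB].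
Qed.

Lemma spow_intbl u v : measurable_fun Omega u -> H10 v ->
  intbl (fun x => spow al (p x) (u x) * v x).
Proof.
move=> mfu Hv; have [iv _] := weight Hv; apply: intbl_le iv _ => //.
  by apply: measurable_funM; [exact: measurable_spow|exact: H10_measurable Hv].
move=> x _; rewrite normrM (ger0_norm (spow_ge0 _ _ _)) ler_wpM2r//.
exact: spow_le.
Qed.

Let sF v x := sprim al (p x) (v x) - sprim al (p x) 0.
Let F v := \int[mu]_(x in Omega) sF v x.

Let sF_intbl v : H10 v -> intbl (sF v).
Proof.
move=> Hv; have [iv _] := weight Hv; apply: intbl_le iv _ => //.
  apply: measurable_funB; apply: measurable_sprim; first exact: H10_measurable Hv.
  exact: measurable_cst.
by move=> x _; have := sprim_lipschitz al01 (v x) 0 (p0 x); rewrite subr0.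
Qed.

Let F_concave u v : H10 u -> H10 v -> F u + F v <= 2 * F (2^-1 *: (u + v)).
Proof.
move=> Hu Hv; have Hm := H10Z oO bO 2^-1 (H10D oO bO Hu Hv).
have [iu iv im] := And3 (sF_intbl Hu) (sF_intbl Hv) (sF_intbl Hm).
rewrite /F -RintegralD// -RintegralZl//; apply: le_Rintegral => //.
- exact: intblD.
- exact: intblZ.
- move=> x _; have := sprim_concave al01 (u x) (v x) (p0 x).
  by rewrite /sF /= -[(2^-1 *: _) x]/(2^-1 * (u x + v x)); lra.
Qed.

Let F_lipschitz u v : H10 u -> H10 v -> (F u - F v) ^+ 2 <= K * energy (u - v) (u - v).
Proof.
move=> Hu Hv; have Huv := H10B oO bO Hu Hv; have [iw hw] := weight Huv.
have [iu iv] := (sF_intbl Hu, sF_intbl Hv).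
apply: le_trans hw; rewrite /F -RintegralB// -[X in X <= _]real_normK ?num_real//.
rewrite lerXn2r ?nnegrE//; first by apply: Rintegral_ge0 => x _; rewrite mulr_ge0// powR_ge0.
have iB := intblB mO iu iv.
apply: le_trans (le_normr_Rintegral mO iB) _; apply: le_Rintegral => //.
  exact: integrable_norm.
move=> x _; have -> : sF u x - sF v x = sprim al (p x) (u x) - sprim al (p x) (v x).
  by rewrite /sF; ring.
exact: sprim_lipschitz.
Qed.

Lemma spow_cvg (q s : R) (t : nat -> R) : 0 < q -> t k @[k --> \oo] --> s ->
  spow al q (t k) @[k --> \oo] --> spow al q s.
Proof.
move=> q0 ts.
have E r : spow al q r = expR (- al * ln (Num.max r q)).
  by rewrite /spow /powR gt_eqF// lt_max q0 orbT.
under eq_fun do rewrite E; rewrite E.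
apply: continuous_cvg; first exact: continuous_expR.
apply: cvgM; first exact: cvg_cst.
apply: continuous_cvg; first by apply: continuous_ln; rewrite lt_max q0 orbT.
under eq_fun do rewrite maxr_absE; rewrite maxr_absE.
apply: cvgM; last exact: cvg_cst.
apply: cvgD; first by apply: cvgD => //; exact: cvg_cst.
by apply: cvg_norm; apply: cvgB => //; exact: cvg_cst.
Qed.

(** The Euler equation of half the energy minus the integral of the concave
    primitive. *)
Theorem truncated_equation : exists2 u, H10 u & forall v, H10 v ->
  energy u v = \int[mu]_(x in Omega) (spow al (p x) (u x) * v x).
Proof.
have [u Hu umin] := @quadratic_concave_min R ('rV[R]_n -> R) H10 energy F K
  (H10_0 oO bO) (H10D oO bO) (H10Z oO bO) (energyC Omega) (energyDl oO bO)
  (energyZl oO bO) (energy_ge0 Omega) (fun f => @energy_complete R n Omega oO bO f n0)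
  F_concave K0 F_lipschitz.
exists u => //.
have key v : H10 v -> \int[mu]_(x in Omega) (spow al (p x) (u x) * v x) <= energy u v.
  move=> Hv; have mv := H10_measurable oO bO Hv; have mfu := H10_measurable oO bO Hu.
  pose U (t : R) := u + t *: v.
  have HU t : H10 (U t) by apply: (H10D oO bO Hu); exact: H10Z.
  (* Using the supergradient at the point u + t v, and not at u, bounds the
   variation of [F] from below; the limit t -> 0 is by dominated convergence. *)
have step (t : R) : 0 < t ->
      \int[mu]_(x in Omega) (spow al (p x) (U t x) * v x) <= energy u v + 2^-1 * t * energy v v.
    move=> t0; have := umin _ (HU t).
    have is_ := spow_intbl (H10_measurable oO bO (HU t)) Hv.
    have Htv := H10Z oO bO t Hv.
    have h : t * \int[mu]_(x in Omega) (spow al (p x) (U t x) * v x) <= F (U t) - F u.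
      have [iU iu] := (sF_intbl (HU t), sF_intbl Hu).
      rewrite /F -RintegralB// -RintegralZl//; apply: le_Rintegral => //.
      - exact: intblZ.
      - exact: intblB.
      - move=> x _; rewrite /sF; have := sprim_supergrad al01 (U t x) (u x) (p0 x).
        rewrite (_ : u x - U t x = - (t * v x)); first by lra.
        by rewrite /U -[(u + _) x]/(u x + t * v x); ring.
    rewrite /U (energy_sqDZ oO bO t Hu Hv) => h2.
    by rewrite -(ler_pM2l t0); exact: variation_le h h2.
  have [] := @dominated_convergence _ _ _ mu Omega mO
    (fun k x => (spow al (p x) (U k.+1%:R^-1 x) * v x)%:E)
    (fun x => (spow al (p x) (u x) * v x)%:E) (fun x => (p x `^ (- al) * `|v x|)%:E).
  - move=> k; apply/measurable_EFinP/measurable_funM => //.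
    by apply: measurable_spow; exact: H10_measurable (HU _).
  - by apply/measurable_EFinP/measurable_funM => //; exact: measurable_spow.
  - apply: aeW => x Ox; apply: cvg_EFin; first exact: nearW.
    apply: cvgM; last exact: cvg_cst.
    apply: spow_cvg => //; rewrite -[X in _ --> X]addr0 -(mul0r (v x)).
    apply: cvgD; first exact: cvg_cst.
    by apply: cvgM; [exact: cvg_harmonic|exact: cvg_cst].
  - by have [] := weight Hv.
  - apply: aeW => x k Ox; rewrite lee_fin normrM (ger0_norm (spow_ge0 _ _ _)) ler_wpM2r//.
    exact: spow_le.
  move=> iu _; rewrite -[X in _ --> X](fineK (integrable_fin_num mO iu)) => /fine_cvgP[_] h.
  have h2 : energy u v + 2^-1 * k.+1%:R^-1 * energy v v @[k --> \oo] --> energy u v.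
    rewrite -[X in _ --> X]addr0 -(mul0r (energy v v)) -(mulr0 2^-1).
    apply: cvgD; first exact: cvg_cst.
    apply: cvgM; last exact: cvg_cst.
    by apply: cvgM; [exact: cvg_cst|exact: cvg_harmonic].
  apply: ler_cvg_to h h2 _; apply: nearW => k; apply: step.
  by rewrite invr_gt0.
move=> v Hv; apply/eqP; rewrite eq_le key// andbT.
have HN := H10N oO bO Hv; have mfu := H10_measurable oO bO Hu.
have := key _ HN; rewrite -scaleN1r (energyZr oO bO (-1) Hv Hu) mulN1r.
rewrite (_ : \int[mu]_(x in Omega) _ = - \int[mu]_(x in Omega) (spow al (p x) (u x) * v x)).
  by rewrite lerN2.
rewrite -[RHS]mulN1r -RintegralZl//; last exact: spow_intbl.
by apply: eq_Rintegral => x _; rewrite -[(-1 *: v) x]/(-1 * v x); ring.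
Qed.

End SingularProblem.

(** * Comparison, uniqueness and existence *)

Section Comparison.
Context {R : realType} {n : nat}.
Variables (Omega : set 'rV[R]_n).
Hypotheses (oO : open Omega) (bO : bounded_set Omega).
Notation mu := (@lebesgue_rV R n).
Notation H10 := (H10 Omega).
Notation energy := (energy Omega).
Implicit Types (u v w : 'rV[R]_n -> R).

Let mO : measurable Omega := open_measurable_rV oO.

Definition pos_part w : 'rV[R]_n -> R := fun x => Num.max (w x) 0.

Lemma pos_part_ge0 w x : 0 <= pos_part w x.
Proof. by rewrite /pos_part le_max lexx orbT. Qed.

Lemma H10_abs v : H10 v ->
  H10 (fun x => `|v x|) /\ energy (fun x => `|v x|) (fun x => `|v x|) <= energy v v.
Proof.
move=> /(H10P oO bO)[G sG]; have sA := strong_grad_abs oO bO sG.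
split; first exact: strong_grad_H10 sA.
rewrite (energyE oO bO sA sA) (energyE oO bO sG sG); apply: ler_sum => i _.
have [_ lA _] := sA; have [_ lG _] := sG.
apply: ip_le => // x _; rewrite /component mxE normrM ler_piMl//.
by rewrite normr_sg lern1 leq_b1.
Qed.

(** The gradient of the positive part is theta grad w with 0 <= theta <= 1,
    whence theta^2 |grad w|^2 <= theta |grad w|^2. On the set where w = 0 the
    formula used here has theta = 1/2. *)
Lemma H10_pos_part w : H10 w ->
  H10 (pos_part w) /\ energy (pos_part w) (pos_part w) <= energy w (pos_part w).
Proof.
move=> /(H10P oO bO)[G sG]; have sP := strong_grad_pos oO bO sG.
split; first exact: strong_grad_H10 sP.
rewrite (energyE oO bO sP sP) (energyE oO bO sG sP); apply: ler_sum => i _.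
have [_ lP _] := sP; have [_ lG _] := sG.
apply: (le_Rintegral mO (L2_mul mO (lP i) (lP i)) (L2_mul mO (lG i) (lP i))) => x _.
rewrite /component mxE; set t := 2^-1 * _.
have t01 : 0 <= t <= 1 by rewrite /t; have [_|_|_] := sgrP (w x); lra.
move: t01; move: t (G x ord0 i) => t g /andP[t0 t1].
have h : 0 <= t * (1 - t) * (g * g) by rewrite -expr2 mulr_ge0 ?sqr_ge0// mulr_ge0// subr_ge0.
lra.
Qed.

Lemma H10_le0 w : (0 < n)%N -> H10 w -> energy w (pos_part w) <= 0 ->
  {ae mu, forall x, Omega x -> w x <= 0}.
Proof.
move=> n0 Hw w0; have [Hp hp] := H10_pos_part Hw.
have := energy_eq0 oO bO n0 Hp (le_trans hp w0); apply: filterS => x /[apply] h.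
by rewrite -h /pos_part le_max lexx.
Qed.

End Comparison.

Section OrderedSubSuper.
Context {R : realType} {n : nat}.
Variables (Omega : set 'rV[R]_n) (al kappa : R) (u0 u1 : 'rV[R]_n -> R).
Hypotheses (oO : open Omega) (bO : bounded_set Omega) (n0 : (0 < n)%N) (al01 : 0 < al < 1).
Notation mu := (@lebesgue_rV R n).
Notation H10 := (H10 Omega).
Notation energy := (energy Omega).
Hypotheses (sub : subsolution Omega al u0) (sup : supersolution Omega al u1)
  (kappa0 : 0 < kappa)
  (bnd : {ae mu, forall x, Omega x -> [/\ 0 < u0 x, u0 x <= u1 x & kappa * u1 x <= u0 x]}).
Implicit Types (u v w : 'rV[R]_n -> R).

Let mO : measurable Omega := open_measurable_rV oO.
Let Hu0 : H10 u0. Proof. by case: sub. Qed.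
Let Hu1 : H10 u1. Proof. by case: sup. Qed.
Let mu0 : measurable_fun Omega u0 := H10_measurable oO bO Hu0.
Let mu1 : measurable_fun Omega u1 := H10_measurable oO bO Hu1.

(** [u0], with the value 1 on the null set where it is not positive, so that the
    truncation level is positive everywhere. *)
Let p x : R := if 0 < u0 x then u0 x else 1.

Let p0 x : 0 < p x. Proof. by rewrite /p; case: ifPn. Qed.

Let mp : measurable_fun Omega p.
Proof.
have mt : measurable_fun [set: R] (fun t : R => if 0 < t then t else 1).
  apply: measurable_fun_ifT => //.
  by apply: measurable_fun_ltr => //; exact: measurable_cst.
by have h := measurableT_comp mt mu0; exact: h.
Qed.

Let bndp : {ae mu, forall x, Omega x -> [/\ p x = u0 x, u0 x <= u1 x,
  0 < u1 x & kappa * u1 x <= p x]}.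
Proof.
apply: filterS bnd => x /[apply] [[h0 h1 h2]].
by rewrite /p h0; split=> //; exact: lt_le_trans h1.
Qed.

(** As the energy is finite, so is the singular integral. *)
Lemma supersolution_bound v : H10 v -> (forall x, 0 <= v x) ->
  (int_sing Omega al u1 v <= (energy u1 v)%:E)%E.
Proof.
move=> Hv v0; have [_ _ h] := sup.
have v0' : ae_le Omega (cst 0) v by apply: aeW => x _.
by have := h v Hv v0'; rewrite (int_grad_energy oO bO Hu1 Hv) sube_ge0 ?orbT.
Qed.

Let measurable_sing u v : measurable_fun Omega u -> measurable_fun Omega v ->
  measurable_fun Omega (fun x => (u x `^ (- al) * v x)%:E).
Proof.
move=> mfu mv; apply/measurable_EFinP; apply: measurable_funM => //.
exact: measurable_powR_fun.
Qed.

(** The supersolution inequality tested with [|v|], followed by Cauchy-Schwarz,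
    bounds the integral of u1^-al |v| by the energy norm of v, and
    p^-al <= kappa^-al u1^-al because kappa u1 <= p. *)
Lemma singular_weight : exists2 K, 0 < K & forall v, H10 v ->
  mu.-integrable Omega (EFin \o (fun x => p x `^ (- al) * `|v x|)) /\
  (\int[mu]_(x in Omega) (p x `^ (- al) * `|v x|)) ^+ 2 <= K * energy v v.
Proof.
pose k := kappa `^ (- al); have k0 : 0 < k by rewrite powR_gt0.
exists (k ^+ 2 * energy u1 u1 + 1).
  by rewrite ltr_wpDl// mulr_ge0 ?sqr_ge0// energy_ge0.
move=> v Hv; have [Ha ea] := H10_abs oO bO Hv.
have mv := H10_measurable oO bO Ha.
have hS := supersolution_bound Ha (fun x => normr_ge0 (v x)).
have le1 : (\int[mu]_(x in Omega) (p x `^ (- al) * `|v x|)%:E <=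
    (k * energy u1 (fun x => `|v x|)%R)%:E)%E.
  rewrite EFinM; apply: (le_trans _ (lee_wpmul2l _ hS)); last by rewrite lee_fin ltW.
  rewrite /int_sing -ge0_integralZl_EFin//; last 3 first.
  - by move=> x _; rewrite lee_fin mulr_ge0// powR_ge0.
  - exact: measurable_sing.
  - exact: ltW.
  apply: ae_ge0_le_integral => //.
  - by move=> x _; rewrite lee_fin mulr_ge0// powR_ge0.
  - exact: measurable_sing.
  - by move=> x _; rewrite lee_fin !mulr_ge0// ?powR_ge0// ltW.
  - by apply: measurable_funeM; exact: measurable_sing.
  apply: filterS bndp => x /[apply] [[_ _ u10 kp]].
  rewrite lee_fin mulrA ler_wpM2r// /k -powRM ?(ltW kappa0) ?(ltW u10)//.
  by apply: powR_antitone => //; rewrite mulr_gt0.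
have ip_ : mu.-integrable Omega (EFin \o (fun x => p x `^ (- al) * `|v x|)).
  apply/integrableP; split; first exact: measurable_sing.
  under eq_integral do rewrite gee0_abs ?lee_fin ?mulr_ge0 ?powR_ge0//.
  by rewrite (le_lt_trans le1)// ltry.
split=> //.
have le2 : \int[mu]_(x in Omega) (p x `^ (- al) * `|v x|) <= k * energy u1 (fun x => `|v x|).
  by rewrite -lee_fin /Rintegral fineK//; exact: integrable_fin_num ip_.
have ge0 : 0 <= \int[mu]_(x in Omega) (p x `^ (- al) * `|v x|).
  by apply: Rintegral_ge0 => x _; rewrite mulr_ge0// powR_ge0.
apply: (@le_trans _ _ ((k * energy u1 (fun x => `|v x|)) ^+ 2)).
  by rewrite lerXn2r// nnegrE// (le_trans ge0).
rewrite exprMn mulrDl mul1r.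
apply: (@le_trans _ _ (k ^+ 2 * (energy u1 u1 * energy v v))); last first.
  by rewrite mulrA lerDl energy_ge0.
apply: ler_wpM2l; first exact: sqr_ge0.
apply: le_trans (energy_cs oO bO Hu1 Ha) _.
by apply: ler_wpM2l; [exact: energy_ge0|exact: ea].
Qed.

(** Above [u0] the truncation is not active. *)
Lemma int_sing_spow z v : H10 z -> ae_le Omega u0 z -> H10 v ->
  int_sing Omega al z v = (\int[mu]_(x in Omega) (spow al (p x) (z x) * v x))%:E.
Proof.
move=> Hz uz Hv; have [K K0 hK] := singular_weight.
have mz := H10_measurable oO bO Hz; have mv := H10_measurable oO bO Hv.
have ii := spow_intbl oO bO al01 mp p0 hK mz Hv.
rewrite /Rintegral fineK; last exact: integrable_fin_num ii.
apply: ae_eq_integral => //.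
- exact: measurable_sing.
- exact: measurable_int ii.
apply: filterS2 uz bndp => x uzx bx Ox; have [pu _ _ _] := bx Ox.
by rewrite /spow max_l// pu; exact: uzx.
Qed.

Lemma weak_solution_spow z v : weak_solution Omega al z -> ae_le Omega u0 z -> H10 v ->
  energy z v = \int[mu]_(x in Omega) (spow al (p x) (z x) * v x).
Proof.
move=> [Hz hz] uz Hv; apply: EFin_inj.
by rewrite -(int_grad_energy oO bO Hz Hv) hz// int_sing_spow.
Qed.

(** Tested with z - w, the two equations give the difference a nonpositive
    energy, since s^-al is nonincreasing in s. *)
Lemma solution_unique z w : weak_solution Omega al z -> ae_le Omega u0 z ->
  weak_solution Omega al w -> ae_le Omega u0 w ->
  {ae mu, forall x, Omega x -> z x = w x}.
Proof.
move=> sz uz sw uw; have [Hz _] := sz; have [Hw _] := sw.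
have Hd := H10B oO bO Hz Hw.
have [K K0 hK] := singular_weight.
have iz := spow_intbl oO bO al01 mp p0 hK (H10_measurable oO bO Hz) Hd.
have iw := spow_intbl oO bO al01 mp p0 hK (H10_measurable oO bO Hw) Hd.
have := @energy_eq0 R n Omega oO bO (z - w) n0 Hd.
have le0 : energy (z - w) (z - w) <= 0.
  rewrite energyBl// (weak_solution_spow sz uz Hd) (weak_solution_spow sw uw Hd).
  rewrite subr_le0; apply: le_Rintegral => // x _.
  rewrite -[(z - w) x]/(z x - w x) -subr_le0 -mulrBl.
  have mono a b : a <= b -> spow al (p x) b <= spow al (p x) a.
    move=> ab; apply: powR_antitone => //; first by rewrite lt_max p0 orbT.
    by rewrite ge_max !le_max ab lexx !orbT.
  have [zw|/ltW zw] := leP (z x) (w x).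
    by rewrite mulr_ge0_le0// ?subr_ge0 ?subr_le0// mono.
  by rewrite mulr_le0_ge0// ?subr_ge0 ?subr_le0// mono.
move=> /(_ le0); apply: filterS => x /[apply] /eqP.
by rewrite subr_eq0 => /eqP.
Qed.

(** The comparison with [u1] uses max(u, p)^-al <= u1^-al where u > u1; the
    comparison with [u0] uses max(u, p) = p where u < u0. *)
Theorem solution_between_exists : exists u, solution_between Omega al u0 u1 u.
Proof.
have [K K0 hK] := singular_weight.
have [u Hu eqn] := truncated_equation oO bO al01 n0 mp p0 K0 hK.
have mfu := H10_measurable oO bO Hu.
have le_u1 : ae_le Omega u u1.
  pose w := u - u1; have Hw : H10 w by exact: H10B.
  have [Hp _] := H10_pos_part oO bO Hw.
  have mw := H10_measurable oO bO Hp.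
  have := H10_le0 oO bO n0 Hw.
  have le0 : energy w (pos_part w) <= 0.
    rewrite energyBl// subr_le0 eqn// -lee_fin.
    apply: le_trans (supersolution_bound Hp (pos_part_ge0 w)).
    have ii := spow_intbl oO bO al01 mp p0 hK mfu Hp.
    rewrite /Rintegral fineK; last exact: integrable_fin_num ii.
    apply: ae_ge0_le_integral => //.
    - by move=> x _; rewrite lee_fin mulr_ge0 ?spow_ge0 ?pos_part_ge0.
    - exact: measurable_int ii.
    - by move=> x _; rewrite lee_fin mulr_ge0 ?powR_ge0 ?pos_part_ge0.
    - exact: measurable_sing.
    apply: filterS bndp => x /[apply] [[pu u01 u10 _]]; rewrite lee_fin.
    rewrite /pos_part /w -[(u - u1) x]/(u x - u1 x).
    have [h|h] := leP (u x - u1 x) 0; first by rewrite !mulr0.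
    rewrite ler_wpM2r ?(ltW h)//; apply: powR_antitone => //.
    by rewrite le_max -subr_ge0 (ltW h).
  move=> /(_ le0); apply: filterS => x /[apply].
  by rewrite /w -[(u - u1) x]/(u x - u1 x) subr_le0.
have ge_u0 : ae_le Omega u0 u.
  pose w := u0 - u; have Hw : H10 w by exact: H10B.
  have [Hp _] := H10_pos_part oO bO Hw.
  have mw := H10_measurable oO bO Hp.
  have := H10_le0 oO bO n0 Hw.
  have le0 : energy w (pos_part w) <= 0.
    rewrite energyBl// eqn//.
    have [_ _ /(_ _ Hp)] := sub.
    have pge : ae_le Omega (cst 0) (pos_part w) by apply: aeW => x _; exact: pos_part_ge0.
    move=> /(_ pge); rewrite (int_grad_energy oO bO Hu0 Hp).
    have ii := spow_intbl oO bO al01 mp p0 hK mfu Hp.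
    have -> : int_sing Omega al u0 (pos_part w) =
        (\int[mu]_(x in Omega) (spow al (p x) (u x) * pos_part w x))%:E.
      rewrite /Rintegral fineK; last exact: integrable_fin_num ii.
      apply: ae_eq_integral => //.
      - exact: measurable_sing.
      - exact: measurable_int ii.
      apply: filterS bndp => x bx Ox; have [pu _ _ _] := bx Ox.
      rewrite /pos_part /w -[(u0 - u) x]/(u0 x - u x).
      have [h|h] := leP (u0 x - u x) 0; first by rewrite !mulr0.
      by rewrite /spow max_r pu// -subr_ge0 ltW.
    by rewrite -EFinB lee_fin.
  move=> /(_ le0); apply: filterS => x /[apply].
  by rewrite /w -[(u0 - u) x]/(u0 x - u x) subr_le0.
exists u; split=> //; split=> // v Hv.
by rewrite (int_grad_energy oO bO Hu Hv) eqn// int_sing_spow.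
Qed.

End OrderedSubSuper.

Theorem theorem2p1 (R : realType) (N : nat) (Omega : set 'rV[R]_N)
    (alpha c1 c2 : R) (u0 u1 : 'rV[R]_N -> R) :
  (0 < N)%N ->
  smooth_bounded_domain Omega ->
  0 < alpha < 1 ->
  subsolution Omega alpha u0 ->
  supersolution Omega alpha u1 ->
  ae_le Omega u0 u1 ->
  {ae lebesgue_rV N, forall x, Omega x ->
     [/\ 0 < c1 * bdist Omega x, c1 * bdist Omega x <= u0 x,
         u0 x <= u1 x & u1 x <= c2 * bdist Omega x]} ->
  exists um uM : 'rV[R]_N -> R,
    [/\ minimal_solution Omega alpha u0 u1 um,
        maximal_solution Omega alpha u0 u1 uM,
        ae_le Omega u0 um, ae_le Omega um uM & ae_le Omega uM u1].
Proof.
move=> N0 [_ oO _ bO _] al01 sub sup _ bnd.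
have [kappa kappa0 bnd'] : exists2 kappa, 0 < kappa &
    {ae lebesgue_rV N, forall x, Omega x ->
      [/\ 0 < u0 x, u0 x <= u1 x & kappa * u1 x <= u0 x]}.
  (* If c1 c2 > 0 then c1 / c2 works, as c1 d <= u0 and u1 <= c2 d. Otherwise
   c1 d and c2 d cannot both be positive, so the hypothesis says that the domain
   is a null set. *)
have [c12|c12] := boolP (0 < c1 * c2).
    have c20 : c2 != 0 by apply: contraTneq c12 => ->; rewrite mulr0 ltxx.
    have k0 : 0 < c1 / c2.
      rewrite (_ : c1 / c2 = c1 * c2 * (c2^-1) ^+ 2); last by field.
      by rewrite mulr_gt0// exprn_even_gt0//= invr_neq0.
    exists (c1 / c2) => //; apply: filterS bnd => x /[apply] [[d0 d1 d2 d3]].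
    split=> //; first exact: lt_le_trans d1.
    apply: le_trans d1; have := ler_wpM2l (ltW k0) d3.
    by rewrite mulrA divfK.
  exists 1 => //; apply: filterS bnd => x /[apply] [[d0 d1 d2 d3]].
  have d4 : 0 < c2 * bdist Omega x by rewrite (lt_le_trans d0)// (le_trans d1)// (le_trans d2).
  exfalso; move/negP: c12; apply.
  have := mulr_gt0 d0 d4; rewrite mulrACA -expr2 pmulr_lgt0//.
  rewrite lt_def sqr_ge0 andbT sqrf_eq0.
  by apply: contraTneq d0 => ->; rewrite mulr0 ltxx.
have [u su] := solution_between_exists oO bO N0 al01 sub sup kappa0 bnd'.
have [wu u0u uu1] := su.
have uniq v : solution_between Omega alpha u0 u1 v ->
    {ae lebesgue_rV N, forall x, Omega x -> u x = v x}.
  move=> [wv u0v _].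
  exact: (solution_unique oO bO N0 al01 sub sup kappa0 bnd' wu u0u wv u0v).
(* By uniqueness every solution in the interval is [u] almost everywhere. *)
exists u, u; split=> //.
- by split=> // v /uniq; apply: filterS => x /[apply] ->.
- by split=> // v /uniq; apply: filterS => x /[apply] ->.
- by apply: aeW => x _.
Qed.
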